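(* Let $q\in\mathbb{N}$, $\lambda>0$, $0<\theta<1$ and $a_1,\dots,a_q>0$, let $\omega=\sqrt{-1}$, and let $\{\bar G(t)\}_{t\ge0}$, $\bar G(t)=(G_1(t),\dots,G_q(t))$, be the multivariate gamma subordinator with these parameters (defined in the context). Then for $i=1,2,\dots,q$ and $j=1,2,\dots,q$, the codifference of $\{G_i(t)\}_{t\ge0}$ and $\{G_j(t)\}_{t\ge0}$ is $$\tau(G_i(t),G_j(t))=\lambda t \ln\Big(\frac{a_ia_j(1-\theta)}{a_ia_j(1-\theta)+\omega a_i-\omega a_j+1}\Big)\mathbb{I}_{\{i\ne j\}} -\lambda t\ln\Big(\frac{a_ia_j(1-\theta)^2}{(a_i(1-\theta)-\omega)(a_j(1-\theta)+\omega)}\Big),$$ where $\mathbb{I}_A$ denotes the indicator function on $A$.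
   Context: For $i=1,\dots,q$, $\{Z_i(t)\}_{t\ge0}$ are independent gamma Lévy processes, where $Z_i(t)$ has the gamma distribution with shape $\lambda t$ and rate $a_i$, i.e. density $\frac{a_i^{\lambda t}}{\Gamma(\lambda t)}x^{\lambda t-1}e^{-a_ix}$, $x>0$. $\{B^-(\lambda t)\}_{t\ge0}$ is a negative binomial Lévy process with parameter $\theta$, i.e. $\Pr\{B^-(\lambda t)=n\}=(1-\theta)^{\lambda t}\binom{n+\lambda t-1}{n}\theta^n$, $n\in\{0,1,2,\dots\}$, and it is independent of the processes $\{Z_i(t)\}_{t\ge0}$. The multivariate gamma subordinator is $\bar G(t)=(G_1(t),\dots,G_q(t))$ with $G_i(t)=Z_i\big(t+\lambda^{-1}B^-(\lambda t)\big)$, $t\ge0$; its component processes are conditionally independent given $\{B^-(\lambda t)\}_{t\ge0}$. The codifference of two random variables $X$ and $Y$ is defined as $\tau(X,Y)=\ln\mathbb{E}(e^{\omega(X-Y)})-\ln\mathbb{E}(e^{\omega X})-\ln\mathbb{E}(e^{-\omega Y})$. *)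

(* Defs.v *)
From HB Require Import structures.
From mathcomp Require Import all_boot all_order all_algebra.
From mathcomp Require Import all_classical all_reals all_analysis.
From mathcomp Require Import complex.

Set Implicit Arguments.
Unset Strict Implicit.
Unset Printing Implicit Defensive.

Import Order.TTheory GRing.Theory Num.Theory.
Import numFieldNormedType.Exports.

Local Open Scope classical_set_scope.
Local Open Scope ring_scope.
Local Open Scope complex_scope.

Section complex_functions.
Context {R : realType}.
Implicit Types z : R[i].

Definition cexp z : R[i] :=
  (expR (complex.Re z))%:C * (cos (complex.Im z) +i* sin (complex.Im z)).

Definition cmod z : R :=
  Num.sqrt (complex.Re z ^+ 2 + complex.Im z ^+ 2).

(* principal argument, in ]-pi, pi] (junk at z = 0) *)
Definition carg z : R :=
  if 0 <= complex.Im z then acos (complex.Re z / cmod z)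
  else - acos (complex.Re z / cmod z).

(* principal logarithm (junk at z = 0) *)
Definition cln z : R[i] := ln (cmod z) +i* carg z.

(* psi is the distinguished logarithm of phi: the unique continuous function
   with psi 0 = 0 and exp (psi u) = phi u for all u.  [R[i]^o] carries the
   topology of the complex modulus. *)
Definition is_distinguished_log (phi psi : R -> R[i]) : Prop :=
  [/\ continuous (psi : R -> (R[i])^o), psi 0 = 0 &
      forall u, cexp (psi u) = phi u].

Definition distinguished_log (phi : R -> R[i]) : R -> R[i] :=
  xget (fun=> 0) [set psi | is_distinguished_log phi psi].

End complex_functions.

Section codifference.
Context d (T : measurableType d) (R : realType) (P : probability T R).

Definition cexpectation (f : T -> R[i]) : R[i] :=
  fine 'E_P[fun w => complex.Re (f w)] +i* fine 'E_P[fun w => complex.Im (f w)].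

Definition char_fun (X : T -> R) (u : R) : R[i] :=
  cexpectation (fun w => cexp ('i * (u * X w)%:C)).

(* ln E(e^{i X}): the logarithm of the characteristic function u |-> E(e^{iuX})
   at u = 1.  As usual for (infinitely divisible) characteristic functions, ln
   is the branch that is continuous in u and vanishes at u = 0; the principal
   value of ln E(e^{iX}) would only agree with it modulo 2 pi i. *)
Definition ln_char (X : T -> R) : R[i] := distinguished_log (char_fun X) 1.

Definition codifference (X Y : T -> R) : R[i] :=
  ln_char (X \- Y) - ln_char X - ln_char (\- Y).

End codifference.

Section processes.
Context d (T : measurableType d) (R : realType) (P : probability T R).

Definition mutually_independent (I : finType) (F : I -> set (set T)) : Prop :=
  forall (J : {set I}) (A : I -> set T), (forall i, i \in J -> F i (A i)) ->
    P (\bigcap_(i in [set` J]) A i) = (\prod_(i in J) fine (P (A i)))%:E.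

Definition independent2 (F G : set (set T)) : Prop :=
  forall A B, F A -> G B -> P (A `&` B) = (P A * P B)%E.

Definition sigma_rv (X : T -> R) : set (set T) :=
  preimage_set_system setT X measurable.

(* processes are indexed by R, but only times t >= 0 matter *)
Definition sigma_process (X : R -> T -> R) : set (set T) :=
  <<s \bigcup_(t in [set t | 0 <= t]) sigma_rv (X t) >>.

Definition independent_increments (X : R -> T -> R) : Prop :=
  forall (n : nat) (t : nat -> R), 0 <= t 0%N ->
    (forall k l, (k <= l)%N -> t k <= t l) ->
    mutually_independent
      (fun k : 'I_n => sigma_rv (X (t k.+1) \- X (t k))).

Definition stationary_increments (X : R -> T -> R) : Prop :=
  forall s t (A : set R), 0 <= s -> s <= t -> measurable A ->
    P ((X t \- X s) @^-1` A) = P (X (t - s) @^-1` A).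

Definition stochastically_continuous (X : R -> T -> R) : Prop :=
  forall t e : R, 0 <= t -> 0 < e ->
    (fun s => P [set w | e < `|X s w - X t w|])
      @ within [set s | 0 <= s] (nbhs t) --> 0%E.

Definition levy_process (X : R -> T -> R) : Prop :=
  (forall t, 0 <= t -> measurable_fun setT (X t)) /\
  [/\ {ae P, forall w, X 0 w = 0},
      independent_increments X,
      stationary_increments X &
      stochastically_continuous X].

Definition Gamma (s : R) : R :=
  \int[lebesgue_measure]_(x in `]0, +oo[) (x `^ (s - 1) * expR (- x)).

Definition gamma_pdf (shape rate x : R) : R :=
  if 0 < x then
    rate `^ shape / Gamma shape * x `^ (shape - 1) * expR (- rate * x)
  else 0.

(* Z(t) has the gamma distribution with shape lambda t and rate a; at t = 0 the
   value is that of any Levy process, namely 0 *)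
Definition gamma_process (lambda a : R) (Z : R -> T -> R) : Prop :=
  levy_process Z /\
  forall t (A : set R), 0 < t -> measurable A ->
    P (Z t @^-1` A) =
    (\int[lebesgue_measure]_(x in A) (gamma_pdf (lambda * t) a x)%:E)%E.

Definition gen_binomial (x : R) (n : nat) : R :=
  (\prod_(k < n) (x - k%:R)) / n`!%:R.

Definition nat_process (B : R -> T -> nat) : R -> T -> R :=
  fun s w => (B s w)%:R.

Definition neg_binomial_process (theta : R) (B : R -> T -> nat) : Prop :=
  levy_process (nat_process B) /\
  forall s n, 0 <= s ->
    P [set w | B s w = n] =
    ((1 - theta) `^ s * gen_binomial (n%:R + s - 1) n * theta ^+ n)%:E.

Definition gamma_subordinator (q : nat) (lambda : R)
    (Z : 'I_q -> R -> T -> R) (B : R -> T -> nat) : 'I_q -> R -> T -> R :=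
  fun i t w => Z i (t + lambda^-1 * (B (lambda * t) w)%:R) w.

End processes.

(* Main.v *)
Require Import Defs.
From HB Require Import structures.
From mathcomp Require Import all_boot all_order all_algebra.
From mathcomp Require Import all_classical all_reals all_analysis.
From mathcomp Require Import measurable_realfun complex ring lra.

Set Implicit Arguments.
Unset Strict Implicit.
Unset Printing Implicit Defensive.

Import Order.TTheory GRing.Theory Num.Theory.
Import numFieldNormedType.Exports.

Local Open Scope classical_set_scope.
Local Open Scope ring_scope.
Local Open Scope complex_scope.

(* Stationary independent increments make s |-> E(g_u(X_s)) multiplicative
   whenever X is a Levy process and g_u turns sums into products; stochastic
   continuity makes it continuous, and continuity in u selects the branch, so
   that E(g_u(X_s)) = exp(s L(u)) as soon as E(g_u(X_1)) = exp(L(u)) with L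
   continuous and L(0) = 0.  With g_u(x) = e^{iux} the gamma processes are thus
   determined by their exponential law at the time where the shape is 1, and
   with g_u(x) = z(u)^x the negative binomial process is determined by its
   geometric law at time 1: no Gamma integral and no binomial series with
   non-integral exponent is needed.

   Conditioning on B^-(lambda t) = n, a linear combination of the components of
   the subordinator with conditional characteristic function
   exp(-(lambda t + n) L(u)) gets the characteristic function
   ((1 - theta) / (exp(L(u)) - theta))^{lambda t}.  The base of this power has
   positive real part for the combinations G_i - G_j (i <> j), G_i and - G_j, so
   its continuous logarithm in u is lambda t times the principal one. *)

(** * Complex exponential and principal logarithm *)

Section complex_exponential.
Context {R : realType}.
Implicit Types (z w : R[i]) (f g : R -> R[i]).

Lemma complexReD z w : complex.Re (z + w) = complex.Re z + complex.Re w.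
Proof. by case: z => ? ?; case: w. Qed.

Lemma complexImD z w : complex.Im (z + w) = complex.Im z + complex.Im w.
Proof. by case: z => ? ?; case: w. Qed.

Lemma complexReM z w : complex.Re (z * w) =
  complex.Re z * complex.Re w - complex.Im z * complex.Im w.
Proof. by case: z => ? ?; case: w. Qed.

Lemma complexImM z w : complex.Im (z * w) =
  complex.Re z * complex.Im w + complex.Im z * complex.Re w.
Proof. by case: z => ? ?; case: w. Qed.

Lemma complexP z w : complex.Re z = complex.Re w ->
  complex.Im z = complex.Im w -> z = w.
Proof. by case: z => ? ?; case: w => ? ? /= -> ->. Qed.

Lemma complexReN z : complex.Re (- z) = - complex.Re z.
Proof. by case: z. Qed.

Lemma complexReMn z n : complex.Re (z *+ n) = complex.Re z *+ n.
Proof. by elim: n => [//|n IH]; rewrite !mulrS complexReD IH. Qed.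

Lemma complex_realM (k : R) z :
  k%:C * z = (k * complex.Re z) +i* (k * complex.Im z).
Proof. by apply: complexP => /=; case: z => x y /=; rewrite mul0r ?subr0 ?addr0. Qed.

Lemma cexpE z : cexp z =
  (expR (complex.Re z) * cos (complex.Im z))
    +i* (expR (complex.Re z) * sin (complex.Im z)).
Proof. by apply: complexP => /=; rewrite mul0r ?subr0 ?addr0. Qed.

Lemma cexpD z w : cexp (z + w) = cexp z * cexp w.
Proof.
rewrite !cexpE complexReD complexImD; apply: complexP => /=;
  rewrite expRD ?cosD ?sinD; ring.
Qed.

Lemma cexp0 : cexp (0 : R[i]) = 1.
Proof. by rewrite cexpE /= expR0 cos0 sin0 mul1r mulr0. Qed.

Lemma cexpMn z n : cexp (z *+ n) = cexp z ^+ n.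
Proof.
elim: n => [|n IH]; first by rewrite mulr0n cexp0.
by rewrite mulrS cexpD IH exprS.
Qed.

Lemma cexpVN z : cexp (- z) * cexp z = 1.
Proof. by rewrite -cexpD addNr cexp0. Qed.

Lemma cexp_neq0 z : cexp z != 0.
Proof.
apply/eqP => z0; have /eqP := cexpVN z.
by rewrite z0 mulr0 eq_sym oner_eq0.
Qed.

Lemma cexpN z : cexp (- z) = (cexp z)^-1.
Proof. by apply: (mulIf (cexp_neq0 z)); rewrite cexpVN mulVf// cexp_neq0. Qed.

(** The sine vanishes, so the cosine is 1 or -1, and positivity of the real exponential excludes -1.
    The imaginary part is known only up to multiples of [2 * pi], hence the conclusion on its
    cosine. *)
Lemma cexp_eq1 z : cexp z = 1 -> complex.Re z = 0 /\ cos (complex.Im z) = 1.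
Proof.
case: z => a b; rewrite cexpE => -[] /= h1 h2.
have e0 := expR_gt0 a.
have sb : sin b = 0 by move/eqP: h2; rewrite mulf_eq0 gt_eqF//= => /eqP.
have cb : cos b ^+ 2 = 1 by rewrite -(cos2Dsin2 b) sb expr0n addr0.
have c1 : cos b = 1.
  move/eqP: cb; rewrite sqrf_eq1 => /orP[/eqP//|/eqP c1].
  by exfalso; move: h1; rewrite c1; lra.
by split=> //; apply: expR_inj; rewrite expR0 -h1 c1 mulr1.
Qed.

(** Taken componentwise, so that real limit lemmas apply to each part; [continuous_complexP]
    identifies it with continuity for the complex modulus. *)
Definition ccontinuous f :=
  continuous (fun u => complex.Re (f u)) /\
  continuous (fun u => complex.Im (f u)).

Lemma ccontinuous_cst z : ccontinuous (fun=> z).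
Proof. by split => u; exact: cvg_cst. Qed.

Lemma ccontinuousD f g : ccontinuous f -> ccontinuous g ->
  ccontinuous (fun u => f u + g u).
Proof.
move=> [f1 f2] [g1 g2]; split => u.
  under eq_fun do rewrite complexReD.
  by apply: cvgD; [exact: f1|exact: g1].
under eq_fun do rewrite complexImD.
by apply: cvgD; [exact: f2|exact: g2].
Qed.

Lemma ccontinuousM f g : ccontinuous f -> ccontinuous g ->
  ccontinuous (fun u => f u * g u).
Proof.
move=> [f1 f2] [g1 g2]; split => u.
  under eq_fun do rewrite complexReM.
  apply: cvgD.
    by apply: cvgM; [exact: f1|exact: g1].
  apply: cvgN.
  by apply: cvgM; [exact: f2|exact: g2].
under eq_fun do rewrite complexImM.
apply: cvgD.
  by apply: cvgM; [exact: f1|exact: g2].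
by apply: cvgM; [exact: f2|exact: g1].
Qed.

Lemma ccontinuousZ z f : ccontinuous f -> ccontinuous (fun u => z * f u).
Proof. by move=> cf; apply: ccontinuousM => //; exact: ccontinuous_cst. Qed.

Lemma ccontinuousN f : ccontinuous f -> ccontinuous (fun u => - f u).
Proof.
move=> /(ccontinuousZ (-1)); congr ccontinuous.
by apply/funext => u; rewrite mulN1r.
Qed.

Lemma ccontinuous_cexp f : ccontinuous f -> ccontinuous (fun u => cexp (f u)).
Proof.
move=> [f1 f2]; split => u; under eq_fun do rewrite cexpE /=.
  apply: cvgM.
    by apply: continuous_comp; [exact: f1|exact: continuous_expR].
  by apply: continuous_comp; [exact: f2|exact: continuous_cos].
apply: cvgM.
  by apply: continuous_comp; [exact: f1|exact: continuous_expR].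
by apply: continuous_comp; [exact: f2|exact: continuous_sin].
Qed.

Lemma complexV z : z^-1 = 
  (complex.Re z / (complex.Re z ^+ 2 + complex.Im z ^+ 2))
    -i* (complex.Im z / (complex.Re z ^+ 2 + complex.Im z ^+ 2)).
Proof. by case: z => a b. Qed.

Lemma Re_gt0_neq0 z : 0 < complex.Re z -> z != 0.
Proof. by move=> z0; apply/eqP => z1; rewrite z1 ltxx in z0. Qed.

Lemma sqr_mod_gt0 z : z != 0 -> 0 < complex.Re z ^+ 2 + complex.Im z ^+ 2.
Proof.
case: z => a b /eqP ab /=; rewrite lt_neqAle addr_ge0 ?sqr_ge0// andbT eq_sym.
apply/negP; rewrite paddr_eq0 ?sqr_ge0// !sqrf_eq0 => /andP[/eqP a0 /eqP b0].
by apply: ab; rewrite a0 b0.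
Qed.

Lemma ReV_gt0 z : 0 < complex.Re z -> 0 < complex.Re z^-1.
Proof.
by move=> z0; rewrite complexV /= divr_gt0// sqr_mod_gt0// Re_gt0_neq0.
Qed.

Lemma ccontinuousV f : (forall u, f u != 0) -> ccontinuous f ->
  ccontinuous (fun u => (f u)^-1).
Proof.
move=> f0 [f1 f2].
have c u : {for u, continuous (fun u =>
    (complex.Re (f u) ^+ 2 + complex.Im (f u) ^+ 2)^-1)}.
  apply: cvgV; first by rewrite gt_eqF// sqr_mod_gt0.
  apply: cvgD.
    by apply: cvgM; exact: f1.
  by apply: cvgM; exact: f2.
split => u; under eq_fun do rewrite complexV /=.
  by apply: cvgM; [exact: f1|exact: c].
apply: cvgN.
by apply: cvgM; [exact: f2|exact: c].
Qed.

(* The norm of R[i] takes values in R[i] itself, so that the radii of the balls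
   of [R[i]^o] are complex numbers that happen to be real. *)
Lemma continuous_complexP f : continuous (f : R -> (R[i])^o) <-> ccontinuous f.
Proof.
split.
  move=> cf; split => u; apply/cvgrPdist_lt => e e0;
    have /cvgrPdist_lt/(_ e%:C) := cf u; rewrite ltcR => /(_ e0);
    apply: filterS => v; rewrite normc_def ltcR; apply: le_lt_trans.
    by rewrite -sqrtr_sqr ler_wsqrtr// -raddfB/= lerDl sqr_ge0.
  by rewrite -sqrtr_sqr ler_wsqrtr// -raddfB/= lerDr sqr_ge0.
move=> [f1 f2] u; apply/cvgrPdist_lt => /= -[e e'].
rewrite ltcE /= => /andP[/eqP-> e0].
have e20 : 0 < e / 2 by rewrite divr_gt0.
have /cvgrPdist_lt/(_ _ e20) h1 := f1 u.
have /cvgrPdist_lt/(_ _ e20) h2 := f2 u.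
apply: filterS2 h1 h2 => v v1 v2.
rewrite normc_def ltcR.
apply: (@le_lt_trans _ _
  (`|complex.Re (f u) - complex.Re (f v)| + 
   `|complex.Im (f u) - complex.Im (f v)|)).
  rewrite -[leRHS]ger0_norm ?addr_ge0// -sqrtr_sqr ler_wsqrtr//.
  rewrite -!raddfB; set a := complex.Re _; set b := complex.Im _.
  rewrite sqrrD !real_normK ?num_real// addrAC lerDl.
  by rewrite mulrn_wge0// mulr_ge0.
by rewrite [ltRHS]splitr ltrD.
Qed.

End complex_exponential.

(** * Principal logarithm on the right half-plane, uniqueness of continuous logarithms *)

Section principal_logarithm.
Context {R : realType}.
Implicit Types (z w : R[i]) (f : R -> R[i]).

Lemma cmod_gt0 z : z != 0 -> 0 < cmod z.
Proof. by move=> z0; rewrite sqrtr_gt0 sqr_mod_gt0. Qed.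

Lemma Re_div_cmod z : 0 < complex.Re z ->
  complex.Re z / cmod z = cos (atan (complex.Im z / complex.Re z)).
Proof.
move=> z0; rewrite cos_atan.
have -> : 1 + (complex.Im z / complex.Re z) ^+ 2 =
    (complex.Re z ^+ 2 + complex.Im z ^+ 2) / complex.Re z ^+ 2.
  by field; rewrite gt_eqF.
rewrite sqrtrM ?addr_ge0 ?sqr_ge0// sqrtrV ?sqr_ge0// sqrtr_sqr gtr0_norm//.
by rewrite invfM invrK mulrC.
Qed.

(** The arctangent lies strictly between [- pi / 2] and [pi / 2] and has the sign of the imaginary
    part, so [acos] inverts the cosine at it or at its opposite. The two cases of [carg] merge into
    one visibly continuous expression. *)
Lemma carg_atan z : 0 < complex.Re z ->
  carg z = atan (complex.Im z / complex.Re z).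
Proof.
move=> z0; rewrite /carg Re_div_cmod//.
set t := _ / complex.Re z.
have := atan_gtNpi2 t; have := atan_ltpi2 t; have := @pi_gt0 R.
move=> pi0 tpi tNpi; case: ifPn => z'.
  rewrite cosK// in_itv /=; apply/andP; split; last by lra.
  by rewrite -atan0 le_atan// divr_ge0// ltW.
rewrite cosKN ?opprK//; apply/andP; split; first by lra.
by rewrite -atan0 le_atan// pmulr_lle0 ?invr_gt0// ltW// ltNge.
Qed.

Lemma cexp_cln z : 0 < complex.Re z -> cexp (cln z) = z.
Proof.
move=> z0; have m0 := cmod_gt0 (Re_gt0_neq0 z0).
rewrite cexpE /= carg_atan// lnK ?posrE//.
set t := _ / complex.Re z.
have ct : cmod z * cos (atan t) = complex.Re z.
  by rewrite -Re_div_cmod// mulrC divfK ?gt_eqF.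
have c0 : cos (atan t) != 0.
  by apply/eqP => c0; move: z0; rewrite -ct c0 mulr0 ltxx.
have -> : sin (atan t) = t * cos (atan t).
  by rewrite -[X in X * _]atanK /tan divfK.
apply: complexP => //=; rewrite mulrCA ct /t divfK// gt_eqF//.
Qed.

Lemma cln1 : cln (1 : R[i]) = 0.
Proof.
apply: complexP => /=; last by rewrite carg_atan//= mul0r atan0.
by rewrite /cmod /= expr0n addr0 expr1n sqrtr1 ln1.
Qed.

Lemma ccontinuous_cln f : (forall u, 0 < complex.Re (f u)) ->
  ccontinuous f -> ccontinuous (fun u => cln (f u)).
Proof.
move=> f0 [f1 f2]; split => u /=.
  apply: (@continuous_comp _ _ _ (fun u => cmod (f u))); last first.
    by apply: continuous_ln; rewrite cmod_gt0// Re_gt0_neq0.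
  apply: (@continuous_comp _ _ _ (fun u =>
    complex.Re (f u) ^+ 2 + complex.Im (f u) ^+ 2)); last exact: sqrt_continuous.
  by apply: cvgD; apply: cvgM; solve [exact: f1|exact: f2].
under eq_fun do rewrite carg_atan//.
apply: (@continuous_comp _ _ _ (fun u => complex.Im (f u) / complex.Re (f u)));
  last exact: continuous_atan.
by apply: cvgM; [exact: f2|apply: cvgV; rewrite ?gt_eqF//; exact: f1].
Qed.

(** Rescaling the segment from 0 to [u] to the unit interval treats both signs of [u] at once. *)
Lemma continuous_IVT (h : R -> R) (u v : R) :
  continuous h -> Num.min (h 0) (h u) <= v <= Num.max (h 0) (h u) ->
  exists c, h c = v.
Proof.
move=> ch hv.
have [||c _ hc] := @IVT R (fun x => h (x * u)) 0 1 v ler01.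
- apply: continuous_subspaceT => x.
  apply: cvg_comp; last exact: ch.
  exact: mulrr_continuous.
- by rewrite mul0r mul1r.
- by exists (c * u).
Qed.

(** The values lie in a discrete set, which a continuous function starting at 0 cannot leave.
    Positive values are excluded first, then negative ones by passing to [- h]. *)
Lemma cos_eq1_continuous (h : R -> R) :
  continuous h -> h 0 = 0 -> (forall u, cos (h u) = 1) -> forall u, h u = 0.
Proof.
have pi0 := @pi_gt0 R.
have nonpos (k : R -> R) : continuous k -> k 0 = 0 ->
    (forall u, cos (k u) = 1) -> forall u, k u <= 0.
  move=> ck k0 k1 u; rewrite leNgt; apply/negP => ku.
  (* Capping at [pi] gives a value of [k] in the range where [acos] inverts the cosine; it would be
     both positive and equal to [acos 1], which is 0. *)
  have m0 : 0 < Num.min (k u) pi by rewrite lt_min ku.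
  have [c kc] : exists c, k c = Num.min (k u) pi.
    apply: (@continuous_IVT _ u) => //; rewrite k0.
    by rewrite ge_min (ltW m0)/= le_max !ge_min lexx/= !orbT.
  have : acos (cos (k c)) = k c.
    by rewrite cosK// in_itv/= kc ltW//= ge_min lexx orbT.
  by rewrite k1 acos1 kc => m1; rewrite -m1 ltxx in m0.
move=> ch h0 h1 u; apply/eqP; rewrite eq_le nonpos//= -oppr_le0.
apply: (nonpos (fun u => - h u)) => [x||x]; last by rewrite cosN.
- by apply: cvgN; exact: ch.
- by rewrite h0 oppr0.
Qed.

(** The difference of two such logarithms has exponential 1: its real part vanishes, and its
    imaginary part is continuous, null at 0 and of cosine 1. *)
Lemma is_distinguished_log_inj (phi psi1 psi2 : R -> R[i]) :
  is_distinguished_log phi psi1 -> is_distinguished_log phi psi2 ->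
  psi1 = psi2.
Proof.
move=> [/continuous_complexP c1 p10 e1] [/continuous_complexP c2 p20 e2].
apply/funext => u; apply/eqP; rewrite -subr_eq0; apply/eqP.
have e v : cexp (psi1 v - psi2 v) = 1.
  by rewrite cexpD cexpN e1 e2 divff// -(e1 v) cexp_neq0.
have [_ c12] := ccontinuousD c1 (ccontinuousN c2).
apply: complexP; first by have [] := cexp_eq1 (e u).
apply: (cos_eq1_continuous c12); first by rewrite p10 p20 subr0.
by move=> v; have [] := cexp_eq1 (e v).
Qed.

Lemma distinguished_logE (phi psi : R -> R[i]) :
  ccontinuous psi -> psi 0 = 0 -> (forall u, cexp (psi u) = phi u) ->
  distinguished_log phi = psi.
Proof.
move=> cpsi psi0 phiE; apply: xget_unique; first by split=> //; exact/continuous_complexP.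
move=> psi' /is_distinguished_log_inj; apply.
by split=> //; exact/continuous_complexP.
Qed.

Lemma cexp_ccontinuous_inj (f g : R -> R[i]) : ccontinuous f -> ccontinuous g ->
  f 0 = 0 -> g 0 = 0 -> (forall u, cexp (f u) = cexp (g u)) -> f = g.
Proof.
move=> cf cg f0 g0 fg; apply: (@is_distinguished_log_inj (cexp \o f)).
  by split => //; exact/continuous_complexP.
by split => [|//|u]; [exact/continuous_complexP|rewrite -fg].
Qed.

End principal_logarithm.

(** * Multiplicative semigroups *)

Section semigroups.
Context {R : realType}.

(** The only possible values are 1 and -1; reaching -1 would force the real part to vanish somewhere
    in between. *)
Lemma sqr_eq1_ccontinuous (g : R -> R[i]) : ccontinuous g -> g 0 = 1 ->
  (forall u, g u ^+ 2 = 1) -> forall u, g u = 1.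
Proof.
move=> [cg _] g0 g1 u.
have gE v : g v = 1 \/ g v = -1.
  by have /eqP := g1 v; rewrite sqrf_eq1 => /orP[]/eqP; [left|right].
have [//|gu] := gE u.
have [] := @continuous_IVT _ (fun u => complex.Re (g u)) u 0 cg.
  by rewrite g0 gu /= ge_min le_max oppr_le0 ler01 orbT.
by move=> c; case: (gE c) => -> /= /eqP; rewrite ?oppr_eq0 oner_eq0.
Qed.

(** Triviality at [tau] passes to [tau / 2 ^+ n] by taking square roots continuously in [u], then to
    multiples of these times by multiplicativity, and finally to every [s] by right continuity at
    time 0. *)
Lemma semigroup_eq1 (tau : R) (H : R -> R -> R[i]) : 0 < tau ->
  (forall (s s' : R) u, 0 <= s -> 0 <= s' -> H (s + s') u = H s u * H s' u) ->
  (forall u, complex.Re (H s u)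
    @[s --> within [set s | 0 <= s] (nbhs (0 : R))] --> (1 : R)) ->
  (forall u, complex.Im (H s u)
    @[s --> within [set s | 0 <= s] (nbhs (0 : R))] --> (0 : R)) ->
  (forall s : R, 0 <= s -> ccontinuous (H s)) ->
  (forall s : R, 0 <= s -> H s 0 = 1) ->
  (forall u, H tau u = 1) ->
  forall (s : R) u, 0 <= s -> H s u = 1.
Proof.
move=> tau0 HD HRe HIm Hc H0 H1.
have step n : 0 < tau / 2 ^+ n by rewrite divr_gt0// exprn_gt0.
have dyadic n u : H (tau / 2 ^+ n) u = 1.
  elim: n u => [|n IH] u; first by rewrite expr0 divr1.
  apply: sqr_eq1_ccontinuous => [||v]; [exact/Hc/ltW|exact/H0/ltW|].
  rewrite expr2 -HD ?ltW// -[RHS](IH v); congr (H _ v).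
  by rewrite exprS; field; rewrite expf_neq0.
have multiples n k u : H ((tau / 2 ^+ n) *+ k) u = 1.
  elim: k => [|k IH].
    have /eqP := HD 0 (tau / 2 ^+ n) u (lexx 0) (ltW (step n)).
    by rewrite add0r dyadic mulr1 mulr0n => /eqP.
  by rewrite mulrS HD ?dyadic ?IH ?mulr1 ?mulrn_wge0// ltW.
move=> s u s0.
(* The remainder of [s] modulo [tau / 2 ^+ n]: it tends to 0 from the right, while [H (r n) u] stays
   equal to [H s u]. *)
pose r n := s - (tau / 2 ^+ n) *+ Num.trunc (s / (tau / 2 ^+ n)).
have rP n : 0 <= r n < tau / 2 ^+ n.
  have h : 0 <= s / (tau / 2 ^+ n) by rewrite divr_ge0// ltW.
  have /andP[] := truncn_itv h.
  rewrite ler_pdivlMr// ltr_pdivrMr// => h1 h2.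
  by rewrite /r -[_ *+ _]mulr_natl subr_ge0 h1 ltrBlDr -[X in X + _]mul1r -mulrDl -mulrS.
have rE n : H (r n) u = H s u.
  have /andP[r0 _] := rP n.
  have -> : s = r n + (tau / 2 ^+ n) *+ Num.trunc (s / (tau / 2 ^+ n)).
    by rewrite /r subrK.
  by rewrite HD// ?mulrn_wge0 ?ltW// multiples mulr1.
have r0 : r n @[n --> \oo] --> within [set s | 0 <= s] (nbhs (0 : R)).
  suff r0 : r n @[n --> \oo] --> (0 : R).
    move=> A hA; have : \forall n \near \oo, 0 <= r n -> A (r n) := r0 _ hA.
    by apply: filterS => n; apply; case/andP: (rP n).
  apply: (@squeeze_cvgr _ _ _ _ (fun=> 0) (fun n => tau / 2 ^+ n)).
  - by apply: nearW => n; case/andP: (rP n) => -> /ltW.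
  - exact: cvg_cst.
  - rewrite -[X in _ --> X](mulr0 tau); apply: cvgMr.
    have : (2^-1 : R) ^+ n @[n --> \oo] --> 0.
      by apply: cvg_expr; rewrite ger0_norm ?invf_lt1// ltr1n.
    by under eq_fun do rewrite exprVn.
have cstP (x l : R) : x @[n --> \oo] --> l -> x = l.
  move=> xl; apply: (@cvg_unique R _ (x @[n --> \oo])) => //.
  exact: cvg_cst.
apply: complexP; apply: cstP.
  have : complex.Re (H (r n) u) @[n --> \oo] --> (1 : R).
    exact: cvg_comp _ _ r0 (HRe u).
  by under eq_fun do rewrite rE.
have : complex.Im (H (r n) u) @[n --> \oo] --> (0 : R).
  exact: cvg_comp _ _ r0 (HIm u).
by under eq_fun do rewrite rE.
Qed.

(* The branch of [F tau ^ (s / tau)] is selected by continuity in [u]. *)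
Lemma semigroup_cexp (tau : R) (F : R -> R -> R[i]) (L : R -> R[i]) : 0 < tau ->
  (forall (s s' : R) u, 0 <= s -> 0 <= s' -> F (s + s') u = F s u * F s' u) ->
  (forall u, complex.Re (F s u)
    @[s --> within [set s | 0 <= s] (nbhs (0 : R))] --> (1 : R)) ->
  (forall u, complex.Im (F s u)
    @[s --> within [set s | 0 <= s] (nbhs (0 : R))] --> (0 : R)) ->
  (forall s : R, 0 <= s -> ccontinuous (F s)) ->
  (forall s : R, 0 <= s -> F s 0 = 1) ->
  ccontinuous L -> L 0 = 0 -> (forall u, F tau u = cexp (L u)) ->
  forall (s : R) u, 0 <= s -> F s u = cexp ((s / tau)%:C * L u).
Proof.
move=> tau0 FD FRe FIm Fc F0 cL L0 F1 s u s0.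
(* Dividing by the expected exponential leaves a semigroup equal to 1 at time [tau], to which
   [semigroup_eq1] applies. *)
pose E (s u : R) := cexp (- ((s / tau)%:C * L u)).
have E0 v : (complex.Re (E s v) @[s --> within [set s | 0 <= s] (nbhs (0 : R))] --> (1 : R))
  /\ (complex.Im (E s v) @[s --> within [set s | 0 <= s] (nbhs (0 : R))] --> (0 : R)).
  have [cRe cIm] : ccontinuous (fun s => E s v).
    rewrite /E; apply/ccontinuous_cexp/ccontinuousN/ccontinuousM.
      by split => /=; [exact: mulrr_continuous|move=> ?; exact: cvg_cst].
    exact: ccontinuous_cst.
  have e0 : E 0 v = 1 by rewrite /E mul0r mul0r oppr0 cexp0.
  have : complex.Re (E s v) @[s --> (0 : R)] --> complex.Re (E 0 v) := cRe 0.
  have : complex.Im (E s v) @[s --> (0 : R)] --> complex.Im (E 0 v) := cIm 0.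
  by rewrite e0 => hIm hRe; split; exact: cvg_within_filter.
have : F s u * E s u = 1.
  apply: (@semigroup_eq1 tau (fun s u => F s u * E s u)) => //.
  - move=> s1 s2 v s10 s20; rewrite FD// /E mulrDl rmorphD mulrDl opprD cexpD; ring.
  - move=> v; have [e1 e2] := E0 v.
    under eq_fun do rewrite complexReM.
    have -> : 1 = 1 * 1 - 0 * 0 :> R by rewrite mulr0 subr0 mulr1.
    by apply: cvgB; apply: cvgM.
  - move=> v; have [e1 e2] := E0 v.
    under eq_fun do rewrite complexImM.
    suff : (complex.Re (F s v) * complex.Im (E s v) +
        complex.Im (F s v) * complex.Re (E s v))
        @[s --> within [set s | 0 <= s] (nbhs (0 : R))] --> (1 * 0 + 0 * 1 : R).
      by rewrite mulr0 mul0r addr0.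
    by apply: cvgD; apply: cvgM.
  - move=> r r0; apply: ccontinuousM; first exact: Fc.
    exact/ccontinuous_cexp/ccontinuousN/ccontinuousZ.
  - by move=> r r0; rewrite F0// /E L0 mulr0 oppr0 cexp0 mulr1.
  - by move=> v; rewrite /E F1 divff ?gt_eqF// mul1r cexpN divff// cexp_neq0.
rewrite /E cexpN => /(congr1 ( *%R^~ (cexp ((s / tau)%:C * L u)))).
by rewrite mul1r mulfVK// cexp_neq0.
Qed.

End semigroups.

(** * Expectations of bounded complex random variables *)

Section bounded_expectation.
Context d (T : measurableType d) (R : realType) (P : probability T R).
Implicit Types (f g : T -> R) (F G : T -> R[i]).

Definition bounded_rv f :=
  measurable_fun [set: T] f /\ exists M : R, forall w, `|f w| <= M.

Lemma bounded_rv_cst c : bounded_rv (cst c).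
Proof. by split; [exact: measurable_cst|exists `|c|]. Qed.

Lemma bounded_rvD f g : bounded_rv f -> bounded_rv g ->
  bounded_rv (fun w => f w + g w).
Proof.
move=> [mf [M fM]] [mg [N gN]]; split; first exact: measurable_funD.
by exists (M + N) => w; rewrite (le_trans (ler_normD _ _))// lerD.
Qed.

Lemma bounded_rvM f g : bounded_rv f -> bounded_rv g ->
  bounded_rv (fun w => f w * g w).
Proof.
move=> [mf [M fM]] [mg [N gN]]; split; first exact: measurable_funM.
by exists (M * N) => w; rewrite normrM ler_pM.
Qed.

Lemma bounded_rvN f : bounded_rv f -> bounded_rv (fun w => - f w).
Proof.
move=> [mf [M fM]]; split; first exact: measurableT_comp.
by exists M => w; rewrite normrN.
Qed.

Lemma bounded_rv_integrable f : bounded_rv f ->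
  P.-integrable [set: T] (EFin \o f).
Proof.
move=> [mf [M fM]]; apply: measurable_bounded_integrable => //.
  by rewrite -ge0_fin_numE// fin_num_measure.
by exists M; split; [exact: num_real|move=> x Mx y _; exact: le_trans (fM y) (ltW Mx)].
Qed.

Definition bounded_crv F :=
  bounded_rv (fun w => complex.Re (F w)) /\
  bounded_rv (fun w => complex.Im (F w)).

Lemma bounded_crvM F G : bounded_crv F -> bounded_crv G ->
  bounded_crv (fun w => F w * G w).
Proof.
move=> [F1 F2] [G1 G2]; split.
  under eq_fun do rewrite complexReM.
  by apply: bounded_rvD; [|apply: bounded_rvN]; exact: bounded_rvM.
by under eq_fun do rewrite complexImM; apply: bounded_rvD; exact: bounded_rvM.
Qed.

Lemma cexpectationE F : cexpectation P F =
  (\int[P]_w complex.Re (F w)) +i* (\int[P]_w complex.Im (F w)).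
Proof. by rewrite /cexpectation unlock. Qed.

Lemma Rintegral_cst_probability (r : R) : \int[P]_w r = r.
Proof.
rewrite Rintegral_cst// -[RHS](mulr1 r) -[in RHS](_ : fine (1%E : \bar R) = 1)//.
by congr (_ * fine _); exact: probability_setT.
Qed.

Lemma cexpectation_cst c : cexpectation P (cst c) = c.
Proof.
by rewrite cexpectationE /= !Rintegral_cst_probability; case: c.
Qed.

Lemma ae_eq_Rintegral f g : bounded_rv f -> bounded_rv g ->
  {ae P, forall w, f w = g w} -> \int[P]_w f w = \int[P]_w g w.
Proof.
move=> [mf _] [mg _] fg; congr fine; apply: ae_eq_integral => //;
  [exact/measurable_EFinP|exact/measurable_EFinP|].
by apply: filterS fg => w fg _ /=; rewrite fg.
Qed.

Lemma ae_eq_cexpectation F G : bounded_crv F -> bounded_crv G ->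
  {ae P, forall w, F w = G w} -> cexpectation P F = cexpectation P G.
Proof.
move=> [F1 F2] [G1 G2] FG; rewrite !cexpectationE.
by congr (_ +i* _); apply: ae_eq_Rintegral => //; apply: filterS FG => w ->.
Qed.

(** Independence makes the joint law a product measure, and Fubini then separates the two
    factors. *)
Lemma Rintegral_indep_rv (X Y : {RV P >-> R}) :
  bounded_rv X -> bounded_rv Y ->
  (forall A B, measurable A -> measurable B ->
    P (X @^-1` A `&` Y @^-1` B) = P (X @^-1` A) * P (Y @^-1` B))%E ->
  \int[P]_w (X w * Y w) = \int[P]_w X w * \int[P]_w Y w.
Proof.
move=> bX bY XY.
have mXY : measurable_fun [set: T] (fun w => (X w, Y w)).
  by apply: measurable_fun_pair.
pose V : {RV P >-> (R * R)%type} :=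
  HB.pack (fun w => (X w, Y w)) (isMeasurableFun.Build _ _ _ _ _ mXY).
pose h (xy : R * R) := (xy.1 * xy.2)%:E.
have mh : measurable_fun [set: R * R] h.
  by apply/measurable_EFinP; apply: measurable_funM.
have iXY : P.-integrable [set: T] (h \o V).
  exact: (bounded_rv_integrable (bounded_rvM bX bY)).
have iX := bounded_rv_integrable bX.
have iY := bounded_rv_integrable bY.
have mEFin : measurable_fun [set: R] (@EFin R) by apply/measurable_EFinP.
(* A measure that factors on rectangles is the product measure. *)
have VE A : measurable A ->
    (distribution P X \x distribution P Y)%E A = distribution P V A.
  by move=> mA; exact: product_measure_unique.
have ih : (distribution P X \x distribution P Y)%E.-integrable setT h.
  apply/integrableP; split => //.
  rewrite (eq_measure_integral (distribution P V)) => [|A mA _].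
    rewrite ge0_integral_distribution//; last exact: measurableT_comp.
    by have /integrableP[] := iXY.
  exact: VE.
have -> : \int[P]_w (X w * Y w) = fine (\int[distribution P V]_z h z)%E.
  by rewrite integral_distribution.
rewrite (eq_measure_integral (distribution P X \x distribution P Y)%E);
  last by move=> A mA _; exact/esym/VE.
rewrite -integral12_prod_meas1// /fubini_F /=.
have fX : (distribution P X).-integrable setT (@EFin R).
  exact: integrable_pushforward.
have fY : (distribution P Y).-integrable setT (@EFin R).
  exact: integrable_pushforward.
under eq_integral => x _.
  rewrite /h /=; under eq_integral do rewrite EFinM.
  rewrite integralZl// -[X in (_ * X)%E]fineK; last exact: integrable_fin_num.
  over.
rewrite integralZr// fineM//; last exact: integrable_fin_num.
by rewrite /= !integral_distribution.
Qed.

(** [S] is a bare family of events of [T], so that several sub-sigma-algebras coexist on one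
    probability space. *)
Definition measurable_wrt (S : set (set T)) f :=
  forall A, measurable A -> S (f @^-1` A).

Lemma Rintegral_indep (S1 S2 : set (set T)) f g :
  independent2 P S1 S2 -> measurable_wrt S1 f -> measurable_wrt S2 g ->
  bounded_rv f -> bounded_rv g ->
  \int[P]_w (f w * g w) = \int[P]_w f w * \int[P]_w g w.
Proof.
move=> ind fS gS bf bg.
pose X : {RV P >-> R} := HB.pack f (isMeasurableFun.Build _ _ _ _ f bf.1).
pose Y : {RV P >-> R} := HB.pack g (isMeasurableFun.Build _ _ _ _ g bg.1).
apply: (@Rintegral_indep_rv X Y) => // A B mA mB.
by apply: ind; [exact: fS|exact: gS].
Qed.

Definition cmeasurable_wrt (S : set (set T)) F :=
  measurable_wrt S (fun w => complex.Re (F w)) /\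
  measurable_wrt S (fun w => complex.Im (F w)).

Lemma cexpectation_indep (S1 S2 : set (set T)) F G :
  independent2 P S1 S2 -> cmeasurable_wrt S1 F -> cmeasurable_wrt S2 G ->
  bounded_crv F -> bounded_crv G ->
  cexpectation P (fun w => F w * G w) = cexpectation P F * cexpectation P G.
Proof.
move=> ind [F1 F2] [G1 G2] [bF1 bF2] [bG1 bG2].
have i := bounded_rv_integrable; have m := bounded_rvM.
rewrite !cexpectationE; apply: complexP => /=.
  under eq_Rintegral do rewrite complexReM.
  by rewrite RintegralB//; [|exact/i/m..];
    rewrite !(Rintegral_indep ind).
under eq_Rintegral do rewrite complexImM.
by rewrite RintegralD//; [|exact/i/m..]; rewrite !(Rintegral_indep ind).
Qed.

Lemma cexpectationZ c F : bounded_crv F ->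
  cexpectation P (fun w => c * F w) = c * cexpectation P F.
Proof.
move=> [F1 F2]; have i f : bounded_rv f -> forall k,
    P.-integrable [set: T] (EFin \o (fun w => k * f w)).
  by move=> bf k; apply/bounded_rv_integrable/bounded_rvM => //; exact: bounded_rv_cst.
rewrite !cexpectationE; apply: complexP => /=.
  under eq_Rintegral do rewrite complexReM.
  rewrite RintegralB//; [|exact: (i _ F1)|exact: (i _ F2)].
  by rewrite !RintegralZl ?complexReM//; exact: bounded_rv_integrable.
under eq_Rintegral do rewrite complexImM.
rewrite RintegralD//; [|exact: (i _ F2)|exact: (i _ F1)].
by rewrite !RintegralZl ?complexImM//; exact: bounded_rv_integrable.
Qed.

End bounded_expectation.

(** * Equality in law, pairwise independence, convergence in probability *)

Section laws.
Context d (T : measurableType d) (R : realType) (P : probability T R).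

Lemma bounded_rv_comp (f : R -> R) (X : T -> R) (M : R) :
  measurable_fun [set: R] f -> (forall x, `|f x| <= M) ->
  measurable_fun [set: T] X -> bounded_rv (fun w => f (X w)).
Proof.
by move=> mf fM mX; split; [exact: measurableT_comp|exists M => w; exact: fM].
Qed.

Lemma eq_law_Rintegral (X Y : T -> R) (f : R -> R) (M : R) :
  measurable_fun [set: T] X -> measurable_fun [set: T] Y ->
  (forall A, measurable A -> P (X @^-1` A) = P (Y @^-1` A)) ->
  measurable_fun [set: R] f -> (forall x, `|f x| <= M) ->
  \int[P]_w f (X w) = \int[P]_w f (Y w).
Proof.
move=> mX mY XY mf fM.
pose X' : {RV P >-> R} := HB.pack X (isMeasurableFun.Build _ _ _ _ X mX).
pose Y' : {RV P >-> R} := HB.pack Y (isMeasurableFun.Build _ _ _ _ Y mY).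
have mEf : measurable_fun [set: R] (EFin \o f) by exact/measurable_EFinP.
have iX : P.-integrable setT ((EFin \o f) \o X').
  exact: bounded_rv_integrable (bounded_rv_comp mf fM mX).
have iY : P.-integrable setT ((EFin \o f) \o Y').
  exact: bounded_rv_integrable (bounded_rv_comp mf fM mY).
congr fine; rewrite -[LHS](integral_distribution mEf iX).
rewrite -[RHS](integral_distribution mEf iY).
by apply: eq_measure_integral => A mA _; exact: XY.
Qed.

Lemma mutually_independent2 (I : finType) (F : I -> set (set T)) (i j : I) :
  i != j -> F i `<=` measurable -> F j `<=` measurable ->
  mutually_independent P F -> independent2 P (F i) (F j).
Proof.
move=> ij Fi Fj ind A B FA FB.
(* Mutual independence is used on the subset made of [i] and [j] only; [B] is also the default event
   at the other indices. *)
pose C k := if k == i then A else B.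
have Ci : C i = A by rewrite /C eqxx.
have Cj : C j = B by rewrite /C eq_sym (negbTE ij).
have FC k : k \in [set i; j]%SET -> F k (C k).
  by rewrite !inE => /orP[]/eqP->; rewrite ?Ci ?Cj.
have := ind _ _ FC.
rewrite big_setU1 ?inE//= big_set1 Ci Cj EFinM.
rewrite (fineK (fin_num_measure P _ (Fi _ FA))) (fineK (fin_num_measure P _ (Fj _ FB))).
move=> <-; congr (P _); apply/seteqP; split => [w [Aw Bw] k /=|w h].
  by rewrite !inE => /orP[]/eqP->; rewrite ?Ci ?Cj.
by split; [rewrite -Ci|rewrite -Cj]; apply: h; rewrite /= !inE eqxx ?orbT.
Qed.

Lemma sigma_rv_measurable (X : T -> R) : measurable_fun [set: T] X ->
  sigma_rv X `<=` measurable.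
Proof. by move=> mX _ [A mA <-]; exact: (mX measurableT _ mA). Qed.

Lemma measurable_wrt_sigma_rv (X : T -> R) (f : R -> R) :
  measurable_fun [set: R] f -> measurable_wrt (sigma_rv X) (fun w => f (X w)).
Proof.
move=> mf A mA; exists (f @^-1` A); last by rewrite setTI.
by rewrite -[X in measurable X]setTI; exact: (mf measurableT _ mA).
Qed.

(** Where [Y s] is small, continuity bounds the error by [e / 2]; elsewhere it is at most [2 * M],
    on an event [N] whose probability tends to 0. *)
Lemma cvg_Rintegral_in_probability (F : set_system R) (Y : R -> T -> R)
    (f : R -> R) (M : R) : Filter F ->
  (\forall s \near F, measurable_fun [set: T] (Y s)) ->
  (forall e, 0 < e -> P [set w | e < `|Y s w|] @[s --> F] --> 0%E) ->
  measurable_fun [set: R] f -> (forall x, `|f x| <= M) ->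
  {for 0, continuous f} ->
  \int[P]_w f (Y s w) @[s --> F] --> f 0.
Proof.
move=> FF mY YP mf fM cf; apply/cvgrPdist_le => e e0.
have M0 : 0 <= M := le_trans (normr_ge0 _) (fM 0).
have e20 : 0 < e / 2 by rewrite divr_gt0.
have [dl /= dl0 fdl] : \forall x \near 0, `|f 0 - f x| < e / 2.
  by move/cvgrPdist_lt : cf; exact.
have d20 : 0 < dl / 2 by rewrite divr_gt0.
(* The added 1 keeps the divisor positive even when [M] is 0. *)
have M10 : 0 < 2 * M + 1 by rewrite ltr_wpDl// mulr_ge0.
have h0 : 0 < e / 2 / (2 * M + 1) by rewrite divr_gt0.
have /fine_cvg/cvgrPdist_lt/(_ _ h0) := YP _ d20.
apply: filterS2 mY => s mYs; rewrite sub0r normrN => Ps.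
pose N := [set w | dl / 2 < `|Y s w|].
have mN : measurable N.
  have -> : N = (Num.norm \o Y s) @^-1` `]dl / 2, +oo[.
    by apply/seteqP; split => w /=; rewrite in_itv/= andbT.
  rewrite -[X in measurable X]setTI.
  have := measurableT_comp (@normr_measurable R setT) mYs.
  by apply => //; exact: measurable_itv.
have bf : bounded_rv (fun w => f (Y s w)) := bounded_rv_comp mf fM mYs.
have bc : bounded_rv (fun w : T => f 0) by exact: bounded_rv_cst.
have bN : bounded_rv (\1_N : T -> R).
  split; first exact/measurable_indicP.
  by exists 1 => w; rewrite indicE; case: (_ \in _); rewrite ?normr1 ?normr0.
have bd := bounded_rvD bc (bounded_rvN bf).
have bu := bounded_rvD (@bounded_rv_cst _ T R (e / 2))
  (bounded_rvM (@bounded_rv_cst _ T R (2 * M)) bN).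
have i := @bounded_rv_integrable _ T R P.
rewrite -[X in `|X - _|](Rintegral_cst_probability P).
rewrite -RintegralB//; [|exact: i..].
apply: (@le_trans _ _ (\int[P]_w `|f 0 - f (Y s w)|)).
  by apply: le_normr_Rintegral => //; exact: i.
apply: (@le_trans _ _ (\int[P]_w (e / 2 + 2 * M * \1_N w))).
  apply: le_Rintegral => //; [exact/integrable_norm/i|exact: i|].
  move=> w _; rewrite indicE.
  have [wN|] := boolP (w \in N).
    rewrite mulr1; apply: (le_trans (ler_normB _ _)).
    by rewrite (le_trans (lerD (fM _) (fM _)))// -mulr2n mulr_natl lerDr ltW.
  rewrite notin_setE /N /= => /negP; rewrite -leNgt => wN.
  rewrite mulr0 addr0 ltW//; apply: fdl => /=.
  by rewrite sub0r normrN (le_lt_trans wN)// ltr_pdivrMr// ltr_pMr// ltr1n.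
rewrite RintegralD//; [|exact/i/bounded_rv_cst|].
  2: by apply/i/bounded_rvM => //; exact: bounded_rv_cst.
rewrite RintegralZl//; last exact: i.
rewrite (Rintegral_cst_probability P).
have -> : \int[P]_w \1_N w = fine (P N).
  by rewrite /Rintegral integral_indic// setIT.
rewrite [leRHS]splitr lerD2l.
have P0 : 0 <= fine (P N) by rewrite fine_ge0.
rewrite (ger0_norm P0) ltr_pdivlMr// mulrC in Ps.
apply: le_trans (ltW Ps).
by rewrite ler_wpM2r// lerDl.
Qed.

End laws.

(** * Characteristic functions of the processes *)

Section levy_semigroup.
Context d (T : measurableType d) (R : realType) (P : probability T R).

(** The bounds ensure integrability. Multiplicativity is asked only on [D] because the functions
    used for the negative binomial process involve the absolute value, additive only on a
    half-line. *)
Definition semicharacter (D : set R) (g : R -> R[i]) :=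
  [/\ ccontinuous g, g 0 = 1,
      forall x, `|complex.Re (g x)| <= 1 /\ `|complex.Im (g x)| <= 1 &
      forall x y, D x -> D y -> g (x + y) = g x * g y].

Variables (D : set R) (g : R -> R -> R[i]).
Hypothesis mD : measurable D.
Hypothesis g_semichar : forall u, semicharacter D (g u).
Hypothesis g_cont : forall x, ccontinuous (g ^~ x).
Hypothesis g_0 : forall x, g 0 x = 1.

Let mgRe u : measurable_fun [set: R] (fun x => complex.Re (g u x)).
Proof. by apply: continuous_measurable_fun; have [[]] := g_semichar u. Qed.

Let mgIm u : measurable_fun [set: R] (fun x => complex.Im (g u x)).
Proof. by apply: continuous_measurable_fun; have [[]] := g_semichar u. Qed.

Let gRe1 u x : `|complex.Re (g u x)| <= 1.
Proof. by have [_ _ /(_ x)[]] := g_semichar u. Qed.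

Let gIm1 u x : `|complex.Im (g u x)| <= 1.
Proof. by have [_ _ /(_ x)[]] := g_semichar u. Qed.

Let bounded_g u (Y : T -> R) : measurable_fun [set: T] Y ->
  bounded_crv (fun w => g u (Y w)).
Proof.
move=> mY; split; first exact: (bounded_rv_comp (mgRe u) (gRe1 u) mY).
exact: (bounded_rv_comp (mgIm u) (gIm1 u) mY).
Qed.

(** Dominated convergence with the constant bound 1, applied to each part. *)
Lemma ccontinuous_cexpectation_semicharacter (Y : T -> R) :
  measurable_fun [set: T] Y ->
  ccontinuous (fun u => cexpectation P (fun w => g u (Y w))).
Proof.
move=> mY.
have h (k : R -> T -> R) : (forall u, measurable_fun [set: T] (k u)) ->
    (forall u w, `|k u w| <= 1) -> (forall w, continuous (k ^~ w)) ->
    continuous (fun u => \int[P]_w k u w).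
  move=> mk k1 ck u.
  apply: (@continuity_under_integral _ _ _ P k setT measurableT
    (u - 1) (u + 1) _ _ (cst 1)).
  - move=> v _; apply: bounded_rv_integrable; split; first exact: mk.
    by exists 1 => w; exact: k1.
  - by apply: aeW => w _ v _; exact: ck.
  - exact: (bounded_rv_integrable P (@bounded_rv_cst _ T R 1)).
  - by move=> v _; apply: aeW => w _; exact: k1.
  - by rewrite inE /= in_itv /= ltrBlDr ltrDl ltr01.
split; under eq_fun do rewrite cexpectationE /=.
  apply: h => [u|//|w]; first exact: (measurableT_comp (mgRe u) mY).
  by have [] := g_cont (Y w).
apply: h => [u|//|w]; first exact: (measurableT_comp (mgIm u) mY).
by have [] := g_cont (Y w).
Qed.

Variables (X : R -> T -> R) (X_levy : levy_process P X).
Hypothesis XD : forall s : R, 0 <= s -> P (X s @^-1` (~` D)) = 0%E.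

Let mX (s : R) : 0 <= s -> measurable_fun [set: T] (X s).
Proof. by case: X_levy => mX _; exact: mX. Qed.

Let mXB (s t : R) : 0 <= s -> 0 <= t -> measurable_fun [set: T] (X s \- X t).
Proof. by move=> s0 t0; apply: measurable_funB; exact: mX. Qed.

Let X0 : {ae P, forall w, X 0 w = 0}.
Proof. by case: X_levy => _ []. Qed.

Let F s u := cexpectation P (fun w => g u (X s w)).

(** Independence is a property of increments, so [X s] is replaced by its increment from time 0,
    almost surely the same. *)
Let F_B0 (s : R) u : 0 <= s -> F s u = cexpectation P (fun w => g u ((X s \- X 0) w)).
Proof.
move=> s0; apply: ae_eq_cexpectation; [exact/bounded_g/mX|exact/bounded_g/mXB|].
by apply: filterS X0 => w /= ->; rewrite subr0.
Qed.

Let F_stationary (s t : R) u : 0 <= s -> 0 <= t ->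
  F t u = cexpectation P (fun w => g u ((X (s + t) \- X s) w)).
Proof.
move=> s0 t0; have st0 := addr_ge0 s0 t0.
have st A : measurable A -> P (X t @^-1` A) = P ((X (s + t) \- X s) @^-1` A).
  have [_ [_ _ sX _]] := X_levy => mA.
  by rewrite sX// ?lerDl// addrAC subrr add0r.
rewrite /F !cexpectationE; congr (_ +i* _).
  exact: (@eq_law_Rintegral _ _ _ _ _ _ _ 1 (mX t0) (mXB st0 s0) st (mgRe u) (gRe1 u)).
exact: (@eq_law_Rintegral _ _ _ _ _ _ _ 1 (mX t0) (mXB st0 s0) st (mgIm u) (gIm1 u)).
Qed.

(** The increments over [0, s] and [s, s + t] are independent, lie in [D] almost surely and add up
    to [X (s + t)]; the second has the law of [X t]. *)
Let F_mul (s t : R) u : 0 <= s -> 0 <= t -> F (s + t) u = F s u * F t u.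
Proof.
move=> s0 t0; have st0 := addr_ge0 s0 t0.
rewrite (F_stationary u s0 t0) (F_B0 u s0).
(* Only the times 0, [s] and [s + t] at indices 0, 1, 2 define the two increments; the sequence
   stays constant afterwards. *)
pose tm k := if k == 0%N then 0 else if k == 1%N then s else s + t.
have [_ [_ iX sX _]] := X_levy.
have tmD k l : (k <= l)%N -> tm k <= tm l.
  by case: k => [|[|k]]; case: l => [|[|l]] //=; rewrite /tm //= lerDl.
have ind : independent2 P (sigma_rv (X s \- X 0)) (sigma_rv (X (s + t) \- X s)).
  apply: (mutually_independent2 (i := ord0) (j := ord_max) _ _ _ (iX 2%N tm _ tmD)) => //.
  - by apply: sigma_rv_measurable; exact: mXB.
  - by apply: sigma_rv_measurable; exact: mXB.
rewrite -(cexpectation_indep ind); last 4 first.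
- by split; [exact: (@measurable_wrt_sigma_rv _ _ _ _ _ (mgRe u))
            |exact: (@measurable_wrt_sigma_rv _ _ _ _ _ (mgIm u))].
- by split; [exact: (@measurable_wrt_sigma_rv _ _ _ _ _ (mgRe u))
            |exact: (@measurable_wrt_sigma_rv _ _ _ _ _ (mgIm u))].
- exact/bounded_g/mXB.
- exact/bounded_g/mXB.
apply: ae_eq_cexpectation.
- exact/bounded_g/mX.
- by apply: bounded_crvM; exact/bounded_g/mXB.
have D1 : {ae P, forall w, D (X s w)}.
  exists (X s @^-1` (~` D)); split => //.
  - rewrite -[X in measurable X]setTI; apply: (mX s0) => //.
    exact: measurableC.
  - exact: XD.
(* By stationarity this increment has the law of [X t], which charges only [D]. *)
have D2 : {ae P, forall w, D ((X (s + t) \- X s) w)}.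
  exists ((X (s + t) \- X s) @^-1` (~` D)); split => //.
  - rewrite -[X in measurable X]setTI; apply: (mXB st0 s0) => //.
    exact: measurableC.
  - rewrite sX ?lerDl//; last exact: measurableC.
    by rewrite addrAC subrr add0r; exact: XD.
move: D1 D2 X0; apply: filterS3 => w /= D1 D2 ->.
have [_ _ _ gM] := g_semichar u.
by rewrite subr0 -gM// addrCA subrr addr0.
Qed.

(** Stochastic continuity at time 0 makes [X s \- X 0] tend to 0 in probability, and [X 0] is almost
    surely 0. *)
Let F_right_cont (f : R -> R) : continuous f -> (forall x, `|f x| <= 1) ->
  \int[P]_w f (X s w) @[s --> within [set s | 0 <= s] (nbhs (0 : R))] --> f 0.
Proof.
move=> cf f1; have [_ [_ _ _ scX]] := X_levy.
have mf : measurable_fun [set: R] f by exact: continuous_measurable_fun.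
have : \int[P]_w f ((X s \- X 0) w)
    @[s --> within [set s | 0 <= s] (nbhs (0 : R))] --> f 0.
  apply: (@cvg_Rintegral_in_probability _ _ _ _ _ _ f 1) => //; last exact: cf.
  - by rewrite near_withinE; apply: nearW => s s0; exact: mXB.
  - by move=> e e0; exact: (scX 0 e (lexx 0) e0).
apply: cvg_trans; apply: near_eq_cvg; rewrite near_withinE; apply: nearW => s s0.
apply: ae_eq_Rintegral.
- exact: (bounded_rv_comp mf f1 (mXB s0 (lexx 0))).
- exact: (bounded_rv_comp mf f1 (mX s0)).
by apply: filterS X0 => w /= ->; rewrite subr0.
Qed.

Lemma levy_semigroup_cexp (tau : R) (L : R -> R[i]) : 0 < tau ->
  ccontinuous L -> L 0 = 0 ->
  (forall u, cexpectation P (fun w => g u (X tau w)) = cexp (L u)) ->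
  forall (s : R) u, 0 <= s ->
    cexpectation P (fun w => g u (X s w)) = cexp ((s / tau)%:C * L u).
Proof.
move=> tau0 cL L0 FL; apply: (semigroup_cexp (F := F)) => //.
- move=> u; have [[cg _] g0 _ _] := g_semichar u.
  under eq_fun do rewrite /F cexpectationE /=.
  by have := F_right_cont cg (gRe1 u); rewrite g0.
- move=> u; have [[_ cg] g0 _ _] := g_semichar u.
  under eq_fun do rewrite /F cexpectationE /=.
  by have := F_right_cont cg (gIm1 u); rewrite g0.
- by move=> s s0; apply: ccontinuous_cexpectation_semicharacter; exact: mX.
- move=> s s0; rewrite /F (_ : (fun w => _) = cst 1) ?cexpectation_cst//.
  by apply/funext => w; rewrite g_0.
Qed.

End levy_semigroup.

(** * Integration against a density, trigonometric moments of the exponential law *)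

Section exponential_law.
Context {R : realType}.
Local Notation mu := (@lebesgue_measure R).

(** The density agrees almost everywhere with the Radon-Nikodym derivative, since both have the same
    integral over every measurable set; the change of variables for the latter then transfers. *)
Lemma ge0_integral_density (Q : probability (measurableTypeR R) R) (p : R -> R) :
  measurable_fun [set: R] p -> (forall x, 0 <= p x) ->
  (forall A, measurable A -> Q A = \int[mu]_(x in A) (p x)%:E)%E ->
  forall f : R -> \bar R, measurable_fun [set: R] f -> (forall x, 0 <= f x)%E ->
  (\int[Q]_x f x = \int[mu]_x (f x * (p x)%:E))%E.
Proof.
move=> mp p0 Qp f mf f0.
have mEp : measurable_fun [set: R] (EFin \o p) by exact/measurable_EFinP.
have Qmu : Q `<< mu.
  apply/null_content_dominatesP => A mA A0; rewrite Qp//.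
  by apply: null_set_integral => //; exact: measurable_funTS.
rewrite -(Radon_Nikodym_SigmaFinite.change_of_variables Qmu f0 measurableT mf).
have fi := Radon_Nikodym_SigmaFinite.f_integrable Qmu.
apply: ge0_ae_eq_integral => //.
- by apply: emeasurable_funM => //; exact: measurable_int fi.
- by apply: emeasurable_funM.
- by move=> x _; rewrite mule_ge0// Radon_Nikodym_SigmaFinite.f_ge0.
- by move=> x _; rewrite mule_ge0// lee_fin.
apply: ae_eqe_mul2l.
apply: integral_ae_eq => // E _ mE.
by rewrite -Radon_Nikodym_SigmaFinite.f_integral//; exact: Qp.
Qed.

Section oscillating_exponential.
Variables (a u c s : R).
Hypothesis a0 : 0 < a.
Hypothesis cs0 : forall x, 0 <= 1 + (c * cos x + s * sin x).

Let den := a ^+ 2 + u ^+ 2.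
Let den0 : 0 < den.
Proof. by rewrite ltr_pwDl ?exprn_gt0 ?sqr_ge0. Qed.

(** The added 1 makes the integrand nonnegative, as the improper form of the fundamental theorem of
    calculus requires. *)
Let h (x : R) : R := a * expR (- a * x) * (1 + (c * cos (u * x) + s * sin (u * x))).

(** The antiderivative of [h] that tends to 0 at infinity, so that the integral is [- H 0]. *)
Let H (x : R) : R := expR (- a * x) *
  (- 1 + a / den * ((c * u - s * a) * sin (u * x) - (c * a + s * u) * cos (u * x))).

Let dH (x : R) : is_derive x (1 : R) H (h x).
Proof.
have den_neq0 : a ^+ 2 + u ^+ 2 != 0 by rewrite gt_eqF.
rewrite /H; apply: is_derive_eq; rewrite /h !scaler1 /GRing.scale /= /den.
by field.
Qed.

Let continuous_h : continuous h.
Proof.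
move=> x; apply: cvgM; first apply: cvgM; first exact: cvg_cst.
- apply: continuous_comp; last exact: continuous_expR.
  exact: mulrl_continuous.
- apply: cvgD; first exact: cvg_cst.
  apply: cvgD; apply: cvgM; try exact: cvg_cst.
    apply: continuous_comp; last exact: continuous_cos.
    exact: mulrl_continuous.
  apply: continuous_comp; last exact: continuous_sin.
  exact: mulrl_continuous.
Qed.

Let H_cvg0 : H x @[x --> +oo%R] --> 0.
Proof.
(* Bounding sine and cosine by 1 gives the domination of [H x] by [expR (- a * x) * K]. *)
pose K := 1 + `|a / den| * (`|c * u - s * a| + `|c * a + s * u|).
have e0 : expR (- a * x) @[x --> +oo%R] --> 0.
  under eq_fun do rewrite mulNr.
  apply: (@cvg_comp _ _ _ (fun x => a * x) (fun z => expR (- z)) _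
    (pinfty_nbhs R)); last exact: cvgr_expR.
  exact: gt0_cvgMry.
apply/norm_cvg0P.
apply: (@squeeze_cvgr _ _ _ _ (fun=> 0) (fun x => expR (- a * x) * K)).
- apply: nearW => x; rewrite normr_ge0 /= normrM ger0_norm ?expR_ge0//.
  rewrite ler_wpM2l ?expR_ge0// (le_trans (ler_normD _ _))// normrN1 lerD2l.
  rewrite normrM ler_wpM2l// (le_trans (ler_normB _ _))// !normrM lerD//.
    by rewrite ler_piMr// ler_norml sin_geN1 sin_le1.
  by rewrite ler_piMr// ler_norml cos_geN1 cos_le1.
- exact: cvg_cst.
- by rewrite -[X in _ --> X](mul0r K); apply: cvgMl.
Qed.

Lemma integral_oscillating_exponential :
  (\int[mu]_(x in `]0%R, +oo[)
    (a * expR (- a * x) * (1 + (c * cos (u * x) + s * sin (u * x))))%:E =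
   (1 + a * (c * a + s * u) / (a ^+ 2 + u ^+ 2))%:E)%E.
Proof.
have mh : measurable_fun (`]0%R, +oo[%classic : set R) (EFin \o h).
  apply/measurable_EFinP; apply: measurable_funTS.
  exact: continuous_measurable_fun continuous_h.
rewrite integral_itv_obnd_cbnd//.
rewrite (@ge0_continuous_FTC2y _ h H 0 0) => [|x x0|||x x0||x _].
- rewrite -EFinB; congr EFin; rewrite /H !mulr0 expR0 sin0 cos0; ring.
- by rewrite mulr_ge0// mulr_ge0 ?expR_ge0 ?(ltW a0).
- exact: continuous_subspaceT.
- exact: H_cvg0.
- by have [] := dH x.
- apply: cvg_at_right_filter; apply/differentiable_continuous/derivable1_diffP.
  by have [] := dH 0.
- by rewrite derive1E; have [_] := dH x.
Qed.

End oscillating_exponential.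

(** With shape 1 the gamma density is the exponential one. The coefficients [c] and [s] let a single
    integral serve for both the cosine and the sine. *)
Lemma Rintegral_exponential_law d (T : measurableType d) (P : probability T R)
    (Z : T -> R) (a u c s : R) : 0 < a ->
  (forall x, 0 <= 1 + (c * cos x + s * sin x)) ->
  measurable_fun [set: T] Z ->
  (forall A : set R, measurable A ->
    P (Z @^-1` A) = \int[lebesgue_measure]_(x in A) (gamma_pdf 1 a x)%:E)%E ->
  \int[P]_w (c * cos (u * Z w) + s * sin (u * Z w)) =
  a * (c * a + s * u) / (a ^+ 2 + u ^+ 2).
Proof.
move=> a0 cs0 mZ ZE.
(* The value at 1 is the total mass of the exponential density of rate 1, the case [u = c = s = 0]
   of the preceding integral. *)
have Gamma1 : Gamma 1 = 1 :> R.
  rewrite /Gamma /Rintegral.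
  have c0 x : (0 : R) <= 1 + (0 * cos x + 0 * sin x).
    by rewrite !mul0r !addr0.
  have := @integral_oscillating_exponential 1 0 0 0 ltr01 c0.
  rewrite !mul0r !addr0 mulr0 mul0r addr0 => h.
  rewrite (_ : (\int[mu]_(x in _) _)%E = 1%E)// -[RHS]h.
  apply: eq_integral => x; rewrite inE /= in_itv /= andbT => x0.
  by rewrite subrr powRr0 !mul1r !mul0r !addr0 mulr1 mulN1r.
have pE x : gamma_pdf 1 a x = if 0 < x then a * expR (- a * x) else 0.
  rewrite /gamma_pdf; case: ifP => // x0.
  by rewrite Gamma1 divr1 powRr1 ?(ltW a0)// subrr powRr0 mulr1.
pose p : R -> R := (fun x => a * expR (- a * x)) \_ `]0%R, +oo[.
have mp : measurable_fun [set: R] p.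
  apply/(measurable_restrictT _ _).1 => //; apply: measurable_funTS.
  apply: continuous_measurable_fun => x; apply: cvgM; first exact: cvg_cst.
  apply: continuous_comp; last exact: continuous_expR.
  exact: mulrl_continuous.
have p0 x : 0 <= p x.
  by rewrite /p patchE; case: ifP => // _; rewrite mulr_ge0 ?expR_ge0// ltW.
have pP x : p x = gamma_pdf 1 a x.
  by rewrite pE /p patchE mem_setE in_itv /= andbT.
pose Z' : {RV P >-> measurableTypeR R} :=
  HB.pack Z (isMeasurableFun.Build _ _ _ (measurableTypeR R) Z mZ).
have ZE' A : measurable A ->
    (distribution P Z' A = \int[mu]_(x in A) (p x)%:E)%E.
  move=> mA; rewrite [LHS]ZE//; apply: eq_integral => x _.
  by rewrite pP.
pose f (x : R) := 1 + (c * cos (u * x) + s * sin (u * x)).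
have cf : continuous (fun x : R => c * cos (u * x) + s * sin (u * x)).
  move=> x; apply: cvgD; apply: cvgM; try exact: cvg_cst.
    apply: continuous_comp; last exact: continuous_cos.
    exact: mulrl_continuous.
  apply: continuous_comp; last exact: continuous_sin.
  exact: mulrl_continuous.
have mEf : measurable_fun [set: R] (EFin \o f).
  apply/measurable_EFinP; apply: continuous_measurable_fun => x.
  by apply: cvgD; [exact: cvg_cst|exact: cf].
have f0 x : (0 <= (EFin \o f) x)%E by rewrite lee_fin cs0.
have := ge0_integral_density mp p0 ZE' mEf f0.
rewrite (_ : (\int[mu]_x _)%E =
    (1 + a * (c * a + s * u) / (a ^+ 2 + u ^+ 2))%:E); last first.
  rewrite -integral_oscillating_exponential// [RHS]integral_mkcond.
  apply: eq_integral => x _; rewrite /p !patchE; case: ifP => _ /=.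
    by rewrite -EFinM mulrC.
  by rewrite mule0.
rewrite ge0_integral_distribution// => /(congr1 fine) /=.
have bf : bounded_rv (fun w => c * cos (u * Z w) + s * sin (u * Z w)).
  apply: (@bounded_rv_comp _ _ _
    (fun x => c * cos (u * x) + s * sin (u * x)) Z (`|c| + `|s|)) => //.
    exact: continuous_measurable_fun.
  move=> x; rewrite (le_trans (ler_normD _ _))// !normrM lerD//.
    by rewrite ler_piMr// ler_norml cos_geN1 cos_le1.
  by rewrite ler_piMr// ler_norml sin_geN1 sin_le1.
(* The constant 1 added for positivity has expectation 1 and cancels on both sides. *)
rewrite -[fine _]/(\int[P]_w (1 + (c * cos (u * Z w) + s * sin (u * Z w)))).
rewrite RintegralD//; last 2 first.
- exact/bounded_rv_integrable/bounded_rv_cst.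
- exact: bounded_rv_integrable.
by rewrite (Rintegral_cst_probability P) => /addrI.
Qed.

End exponential_law.

(** * Characteristic functions of gamma processes *)

Section gamma_char_fun.
Context {R : realType}.

Lemma cexp_i (x : R) : cexp ('i * x%:C) = cos x +i* sin x.
Proof.
by rewrite cexpE /= !(mul0r, mul1r, mulr0, oppr0, addr0, add0r, expR0).
Qed.

Lemma norm_ReIm_cexp_le1 (z : R[i]) : complex.Re z <= 0 ->
  `|complex.Re (cexp z)| <= 1 /\ `|complex.Im (cexp z)| <= 1.
Proof.
move=> z0; have e1 : `|expR (complex.Re z)| <= 1.
  by rewrite ger0_norm ?expR_ge0// -expR0 ler_expR.
rewrite cexpE /= !normrM; split; rewrite -[leRHS]mulr1 ler_pM// ler_norml.
  by rewrite cos_geN1 cos_le1.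
by rewrite sin_geN1 sin_le1.
Qed.

Lemma ccontinuous_real (f : R -> R) : continuous f -> ccontinuous (fun u => (f u)%:C).
Proof. by move=> cf; split => u /=; [exact: cf|exact: cvg_cst]. Qed.

Lemma ccontinuous_i_scale (k : R) : ccontinuous (fun u : R => 'i * (k * u)%:C).
Proof.
apply: ccontinuousZ; apply: ccontinuous_real => u.
exact: mulrl_continuous.
Qed.

Lemma semicharacter_cexp_i (u : R) :
  semicharacter setT (fun x : R => cexp ('i * (u * x)%:C)).
Proof.
split => [|||x y _ _].
- exact/ccontinuous_cexp/ccontinuous_i_scale.
- by rewrite mulr0 rmorph0 mulr0 cexp0.
- by move=> x; apply: norm_ReIm_cexp_le1; rewrite complexReM /= !(mul0r, mulr0, mul1r, oppr0, addr0).
- by rewrite -cexpD mulrDr rmorphD mulrDr.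
Qed.

Lemma measurable_cexp_i (u : R) :
  measurable_fun [set: R] (fun x => complex.Re (cexp ('i * (u * x)%:C))) /\
  measurable_fun [set: R] (fun x => complex.Im (cexp ('i * (u * x)%:C))).
Proof.
have [[cRe cIm] _ _ _] := semicharacter_cexp_i u.
by split; exact: continuous_measurable_fun.
Qed.

Lemma bounded_crv_cexp_i d (T : measurableType d) (X : T -> R) (u : R) :
  measurable_fun [set: T] X -> bounded_crv (fun w => cexp ('i * (u * X w)%:C)).
Proof.
have [mRe mIm] := measurable_cexp_i u; have [_ _ c1 _] := semicharacter_cexp_i u.
move=> mX; split; first exact: (bounded_rv_comp mRe (fun x => (c1 x).1) mX).
exact: (bounded_rv_comp mIm (fun x => (c1 x).2) mX).
Qed.

Context d (T : measurableType d) (P : probability T R).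

(** At time [lambda^-1] the shape is 1 and the characteristic function is the inverse of
    [1 - 'i * (a^-1 * u)%:C]. This base has real part 1, so its principal logarithm is continuous in
    [u], and [levy_semigroup_cexp] carries the formula to all times. *)
Lemma gamma_process_char_fun (lambda a : R) (Z : R -> T -> R) :
  0 < lambda -> 0 < a -> gamma_process P lambda a Z ->
  forall s u : R, 0 <= s ->
    cexpectation P (fun w => cexp ('i * (u * Z s w)%:C)) =
    cexp ((- (lambda * s))%:C * cln (1 - 'i * (a^-1 * u)%:C)).
Proof.
move=> l0 a0 [levyZ gammaZ] s u s0.
have tau0 : 0 < lambda^-1 by rewrite invr_gt0.
have mZ : measurable_fun setT (Z lambda^-1) by case: levyZ => mZ _; exact/mZ/ltW.
have Re1 v : complex.Re (1 - 'i * (a^-1 * v)%:C) = 1 :> R.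
  by rewrite complexReD /= !(mul0r, mulr0, mul1r, oppr0, addr0).
have Re0 v : 0 < complex.Re (1 - 'i * (a^-1 * v)%:C) :> R by rewrite Re1.
pose L (v : R) : R[i] := - cln (1 - 'i * (a^-1 * v)%:C).
have -> : (- (lambda * s))%:C * cln (1 - 'i * (a^-1 * u)%:C) =
    (s / lambda^-1)%:C * L u.
  by rewrite /L invrK mulrN rmorphN mulNr (mulrC s).
apply: (@levy_semigroup_cexp _ _ _ P setT (fun u x => cexp ('i * (u * x)%:C))
  _ _ _ _ Z levyZ _ lambda^-1 L) => //.
- exact: semicharacter_cexp_i.
- move=> x; apply: ccontinuous_cexp.
  rewrite (_ : (fun u => _) = fun u => 'i * (x * u)%:C).
    exact: ccontinuous_i_scale.
  by apply/funext => v; rewrite (mulrC x).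
- by move=> x; rewrite mul0r rmorph0 mulr0 cexp0.
- by move=> r r0; rewrite setCT preimage_set0 measure0.
- apply/ccontinuousN/ccontinuous_cln => //.
  apply: ccontinuousD; first exact: ccontinuous_cst.
  exact/ccontinuousN/ccontinuous_i_scale.
- by rewrite /L mulr0 rmorph0 mulr0 subr0 cln1 oppr0.
move=> v.
rewrite /L cexpN cexp_cln// cexpectationE.
have gammaZ1 A : measurable A ->
    (P (Z lambda^-1%R @^-1` A) = \int[lebesgue_measure]_(x in A) (gamma_pdf 1 a x)%:E)%E.
  have <- : lambda * lambda^-1 = 1 by rewrite divff// gt_eqF.
  by move=> mA; exact: gammaZ.
have E (c k : R) : (forall x, 0 <= 1 + (c * cos x + k * sin x)) ->
    \int[P]_w (c * cos (v * Z lambda^-1 w) + k * sin (v * Z lambda^-1 w)) =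
    a * (c * a + k * v) / (a ^+ 2 + v ^+ 2).
  by move=> ck; exact: Rintegral_exponential_law.
(* The coefficients (1, 0), then (0, 1), isolate the cosine and the sine; positivity holds because
   both functions are at least -1. *)
have Ecos : \int[P]_w cos (v * Z lambda^-1 w) = a ^+ 2 / (a ^+ 2 + v ^+ 2).
  have <- : a * (1 * a + 0 * v) / (a ^+ 2 + v ^+ 2) = a ^+ 2 / (a ^+ 2 + v ^+ 2).
    by congr (_ / _); ring.
  rewrite -E => [|x]; last by rewrite mul0r addr0 mul1r -lerBlDl sub0r cos_geN1.
  by apply: eq_Rintegral => w _; rewrite mul0r addr0 mul1r.
have Esin : \int[P]_w sin (v * Z lambda^-1 w) = a * v / (a ^+ 2 + v ^+ 2).
  have <- : a * (0 * a + 1 * v) / (a ^+ 2 + v ^+ 2) = a * v / (a ^+ 2 + v ^+ 2).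
    by congr (_ / _); ring.
  rewrite -E => [|x]; last by rewrite mul0r add0r mul1r -lerBlDl sub0r sin_geN1.
  by apply: eq_Rintegral => w _; rewrite mul0r add0r mul1r.
have den : a ^+ 2 + v ^+ 2 != 0 by rewrite gt_eqF// ltr_pwDl ?exprn_gt0 ?sqr_ge0.
have a_neq0 : a != 0 by rewrite gt_eqF.
rewrite -[LHS]/(_ +i* _) complexV; congr (_ +i* _).
  transitivity (\int[P]_w cos (v * Z lambda^-1 w)).
    by apply: eq_Rintegral => w _; rewrite cexp_i.
  rewrite Ecos /= !(mul0r, mulr0, mul1r, oppr0, addr0, add0r).
  by field; rewrite a_neq0 sqrrN den.
transitivity (\int[P]_w sin (v * Z lambda^-1 w)).
  by apply: eq_Rintegral => w _; rewrite cexp_i.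
rewrite Esin /= !(mul0r, mulr0, mul1r, oppr0, addr0, add0r).
by field; rewrite a_neq0 sqrrN den.
Qed.

End gamma_char_fun.

(** * Subordination *)

Section countable_mixture.
Context d (T : measurableType d) (R : realType) (P : probability T R).
Variable N : T -> nat.
Hypothesis mN : forall n, measurable [set w | N w = n].

Lemma measurable_fun_nat_mixture (Y : nat -> T -> R) :
  (forall n, measurable_fun [set: T] (Y n)) ->
  measurable_fun [set: T] (fun w => Y (N w) w).
Proof.
move=> mY _ A mA.
rewrite (_ : _ `&` _ = \bigcup_n ([set w | N w = n] `&` (Y n @^-1` A))).
  apply: bigcup_measurable => n _; apply: measurableI => //.
  by rewrite -[X in measurable X]setTI; exact: mY.
apply/seteqP; split => [w [_ YA]|w [n _ [/= <- YA]]]; last by split.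
by exists (N w).
Qed.

Lemma bounded_rv_nat_eq n : bounded_rv (fun w => (N w == n)%:R : R).
Proof.
split.
  rewrite (_ : (fun w => _) = \1_[set w | N w = n]); first exact/measurable_indicP.
  apply/funext => w; rewrite indicE; congr (_%:R); congr nat_of_bool.
  by apply/idP/idP; rewrite inE => /eqP.
by exists 1 => w; case: (N w == n); rewrite ?normr1 ?normr0.
Qed.

(** The partial sum is the expectation of [Y] on the event [N < k], and dominated convergence
    applies with the bound of [Y]. *)
Lemma Rintegral_nat_cvg (Y : T -> R) : bounded_rv Y ->
  \sum_(n < k) \int[P]_w (Y w * (N w == n)%:R) @[k --> \oo] --> \int[P]_w Y w.
Proof.
move=> bY; have [mY [M YM]] := bY.
have bYn k : bounded_rv (fun w => Y w * (N w < k)%N%:R).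
  elim: k => [|k IH].
    by under eq_fun do rewrite ltn0 mulr0; exact: bounded_rv_cst.
  have := bounded_rvD IH (bounded_rvM bY (bounded_rv_nat_eq k)).
  congr bounded_rv; apply/funext => w; rewrite -mulrDr -natrD; congr (_ * _%:R).
  by rewrite ltnS [in RHS]leq_eqVlt; case: ltngtP.
have -> : (fun k => \sum_(n < k) \int[P]_w (Y w * (N w == n)%:R)) =
    (fun k => \int[P]_w (Y w * (N w < k)%N%:R)).
  apply/funext => k; elim: k => [|k IH].
    rewrite big_ord0; under eq_Rintegral do rewrite ltn0 mulr0.
    by rewrite Rintegral_cst_probability.
  rewrite big_ord_recr /= IH -RintegralD//; last 2 first.
  - exact: bounded_rv_integrable.
  - by apply/bounded_rv_integrable/bounded_rvM => //; exact: bounded_rv_nat_eq.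
  apply: eq_Rintegral => w _; rewrite -mulrDr -natrD; congr (_ * _%:R).
  by rewrite ltnS [in RHS]leq_eqVlt; case: ltngtP.
apply: fine_cvg; rewrite fineK; last exact/integrable_fin_num/bounded_rv_integrable.
apply: (@dominated_cvg _ _ _ P setT _ _ _ (EFin \o cst M)) => //.
- by move=> n; apply/measurable_EFinP; have [] := bYn n.
- move=> w _; apply: cvg_EFin; first exact: nearW.
  apply: cvg_near_cst; exists (N w).+1 => // k /= Nk.
  by rewrite Nk mulr1.
- exact: (bounded_rv_integrable P (@bounded_rv_cst _ T R M)).
- move=> n w _ /=; rewrite lee_fin normrM (le_trans _ (YM w))//.
  by rewrite ler_piMr//; case: (_ < _)%N; rewrite ?normr1 ?normr0.
Qed.

Lemma eq_Rintegral_nat (Y1 Y2 : T -> R) : bounded_rv Y1 -> bounded_rv Y2 ->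
  (forall n, \int[P]_w (Y1 w * (N w == n)%:R) = \int[P]_w (Y2 w * (N w == n)%:R)) ->
  \int[P]_w Y1 w = \int[P]_w Y2 w.
Proof.
move=> b1 b2 Y12; apply: (@cvg_unique R _ (\sum_(n < k)
  \int[P]_w (Y1 w * (N w == n)%:R) @[k --> \oo])) => //.
  exact: Rintegral_nat_cvg.
rewrite (_ : (fun k => _) =
    fun k => \sum_(n < k) \int[P]_w (Y2 w * (N w == n)%:R)).
  exact: Rintegral_nat_cvg.
by apply/funext => k; apply: eq_bigr => n _.
Qed.

(** Conditioning on a countable variable is done event by event: on [N = n], independence turns both
    sides into the probability of the event times the expectation of [Y n]. *)
Lemma Rintegral_nat_mixture (S1 S2 : set (set T)) (Y : nat -> T -> R) (M : R) :
  independent2 P S1 S2 -> (forall A, S1 [set w | A (N w)]) ->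
  (forall n, bounded_rv (Y n)) -> (forall n, measurable_wrt S2 (Y n)) ->
  (forall n w, `|Y n w| <= M) ->
  \int[P]_w Y (N w) w = \int[P]_w (\int[P]_v Y (N w) v).
Proof.
move=> ind NS1 bY YS2 YM.
have bYN : bounded_rv (fun w => Y (N w) w).
  split; last by exists M => w; exact: YM.
  by apply: measurable_fun_nat_mixture => n; have [] := bY n.
have bEN : bounded_rv (fun w => \int[P]_v Y (N w) v).
  split.
    by apply: (measurable_fun_nat_mixture (Y := fun n _ => \int[P]_v Y n v)).
  exists M => w; apply: (@le_trans _ _ (\int[P]_v `|Y (N w) v|)).
    by apply: le_normr_Rintegral => //; exact: bounded_rv_integrable.
  rewrite -[leRHS](Rintegral_cst_probability P); apply: le_Rintegral => //.
  - exact/integrable_norm/bounded_rv_integrable.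
  - exact/bounded_rv_integrable/bounded_rv_cst.
apply: eq_Rintegral_nat => // n.
transitivity (\int[P]_w ((N w == n)%:R * Y n w)).
  by apply: eq_Rintegral => w _; case: eqP => [->|_]; rewrite ?mulr1 ?mul1r// mulr0 mul0r.
rewrite (Rintegral_indep ind)//; last exact: bounded_rv_nat_eq.
  rewrite -RintegralZr//; last exact/bounded_rv_integrable/bounded_rv_nat_eq.
  by apply: eq_Rintegral => w _; case: eqP => [->|_]; rewrite ?mulr1 ?mul1r// mulr0 mul0r.
by move=> A mA; exact: (NS1 (fun k => A (k == n)%:R)).
Qed.

Lemma cexpectation_nat_mixture (S1 S2 : set (set T)) (Y : nat -> T -> R[i]) :
  independent2 P S1 S2 -> (forall A, S1 [set w | A (N w)]) ->
  (forall n, bounded_crv (Y n)) -> (forall n, cmeasurable_wrt S2 (Y n)) ->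
  (forall n w, `|complex.Re (Y n w)| <= 1 /\ `|complex.Im (Y n w)| <= 1) ->
  cexpectation P (fun w => Y (N w) w) =
  cexpectation P (fun w => cexpectation P (Y (N w))).
Proof.
move=> ind NS1 bY YS2 Y1; rewrite !cexpectationE.
congr (_ +i* _).
  under [RHS]eq_Rintegral do rewrite cexpectationE /=.
  apply: (Rintegral_nat_mixture (Y := fun n w => complex.Re (Y n w)) ind NS1) => [n|n|n w].
  - by have [] := bY n.
  - by have [] := YS2 n.
  - by have [h _] := Y1 n w; exact: h.
under [RHS]eq_Rintegral do rewrite cexpectationE /=.
apply: (Rintegral_nat_mixture (Y := fun n w => complex.Im (Y n w)) ind NS1) => [n|n|n w].
- by have [] := bY n.
- by have [] := YS2 n.
- by have [_ h] := Y1 n w; exact: h.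
Qed.

End countable_mixture.

(** * Generating functions of the negative binomial process *)

Section negative_binomial.
Context d (T : measurableType d) (R : realType) (P : probability T R).

(** The partial geometric sums [S k] converge to the expectation [F] by countable additivity, so [F]
    inherits their recurrence and solves a linear equation whose coefficient has positive real
    part. *)
Lemma geometric_generating_function (N : T -> nat) (theta : R) (l : R[i]) :
  0 < theta -> theta < 1 -> 0 <= complex.Re l ->
  (forall n, measurable [set w | N w = n]) ->
  (forall n, P [set w | N w = n] = ((1 - theta) * theta ^+ n)%:E) ->
  cexpectation P (fun w => cexp (- l) ^+ N w) =
  (1 - theta)%:C / (1 - theta%:C * cexp (- l)).
Proof.
move=> th0 th1 l0 mN PN; set z := cexp (- l).
have z1 n : `|complex.Re (z ^+ n)| <= 1 /\ `|complex.Im (z ^+ n)| <= 1.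
  rewrite /z -cexpMn; apply: norm_ReIm_cexp_le1.
  by rewrite complexReMn complexReN mulrn_wle0// oppr_le0.
have b : bounded_crv (fun w => z ^+ N w).
  split; split; [|by exists 1 => w; case: (z1 (N w))|
                  |by exists 1 => w; case: (z1 (N w))].
    exact: (measurable_fun_nat_mixture mN (Y := fun n _ => complex.Re (z ^+ n))).
  exact: (measurable_fun_nat_mixture mN (Y := fun n _ => complex.Im (z ^+ n))).
have partE (f : R[i] -> R) n : \int[P]_w (f (z ^+ N w) * (N w == n)%:R) =
    f (z ^+ n) * ((1 - theta) * theta ^+ n).
  transitivity (\int[P]_w (f (z ^+ n) * \1_[set w | N w = n] w)).
    apply: eq_Rintegral => w _; rewrite indicE.
    have [<-|Nn] := eqVneq (N w) n; first by rewrite mem_set.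
    by rewrite memNset ?mulr0//; exact/eqP.
  rewrite RintegralZl//; last exact: integrable_indic.
  transitivity (f (z ^+ n) * fine (P [set w | N w = n])); last by rewrite PN.
  by rewrite /Rintegral integral_indic// setIT.
pose S k := \sum_(n < k) (1 - theta)%:C * (theta%:C * z) ^+ n.
have termE n : (1 - theta)%:C * (theta%:C * z) ^+ n =
    ((1 - theta) * theta ^+ n)%:C * z ^+ n.
  by rewrite exprMn rmorphM rmorphXn mulrA.
have ReS k : complex.Re (S k) =
    \sum_(n < k) \int[P]_w (complex.Re (z ^+ N w) * (N w == n)%:R).
  elim: k => [|k IH]; first by rewrite /S !big_ord0.
  rewrite /S !big_ord_recr /= complexReD -/(S k) IH partE; congr (_ + _).
  by rewrite termE complex_realM /= mulrC.
have ImS k : complex.Im (S k) =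
    \sum_(n < k) \int[P]_w (complex.Im (z ^+ N w) * (N w == n)%:R).
  elim: k => [|k IH]; first by rewrite /S !big_ord0.
  rewrite /S !big_ord_recr /= complexImD -/(S k) IH partE; congr (_ + _).
  by rewrite termE complex_realM /= mulrC.
set F := cexpectation P _.
have cRe : complex.Re (S k) @[k --> \oo] --> complex.Re F.
  rewrite /F cexpectationE (_ : (fun k => _) = fun k =>
    \sum_(n < k) \int[P]_w (complex.Re (z ^+ N w) * (N w == n)%:R)).
    by apply: Rintegral_nat_cvg => //; case: b.
  by apply/funext => k; rewrite ReS.
have cIm : complex.Im (S k) @[k --> \oo] --> complex.Im F.
  rewrite /F cexpectationE (_ : (fun k => _) = fun k =>
    \sum_(n < k) \int[P]_w (complex.Im (z ^+ N w) * (N w == n)%:R)).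
    by apply: Rintegral_nat_cvg => //; case: b.
  by apply/funext => k; rewrite ImS.
have SS k : S k.+1 = (1 - theta)%:C + theta%:C * z * S k.
  rewrite /S big_ord_recl expr0 mulr1 mulr_sumr; congr (_ + _).
  by apply: eq_bigr => n _; rewrite exprS mulrCA.
(* Both sides are limits of [S k.+1], computed by a shift of the index and by the recurrence
   [SS]. *)
have FE : F = (1 - theta)%:C + theta%:C * z * F.
  apply: complexP.
    apply: (@cvg_unique R _ (complex.Re (S k.+1) @[k --> \oo])) => //.
      by have := cRe; rewrite -(cvg_shiftS (fun k => complex.Re (S k))).
    rewrite (_ : (fun k => _) = fun k => complex.Re (1 - theta)%:C +
      (complex.Re (theta%:C * z) * complex.Re (S k) -
       complex.Im (theta%:C * z) * complex.Im (S k))).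
      2: by apply/funext => k; rewrite SS complexReD [complex.Re (_ * S k)]complexReM.
    rewrite complexReD [complex.Re (_ * F)]complexReM; apply: cvgD; first exact: cvg_cst.
    by apply: cvgB; apply: cvgM => //; exact: cvg_cst.
  apply: (@cvg_unique R _ (complex.Im (S k.+1) @[k --> \oo])) => //.
    by have := cIm; rewrite -(cvg_shiftS (fun k => complex.Im (S k))).
  rewrite (_ : (fun k => _) = fun k => complex.Im (1 - theta)%:C +
    (complex.Re (theta%:C * z) * complex.Im (S k) +
     complex.Im (theta%:C * z) * complex.Re (S k))).
    2: by apply/funext => k; rewrite SS complexImD [complex.Im (_ * S k)]complexImM.
  rewrite complexImD [complex.Im (_ * F)]complexImM; apply: cvgD; first exact: cvg_cst.
  by apply: cvgD; apply: cvgM => //; exact: cvg_cst.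
have den : 1 - theta%:C * z != 0.
  apply: Re_gt0_neq0; rewrite complexReD complex_realM /= subr_gt0.
  have [+ _] := z1 1%N; rewrite expr1 ler_norml => /andP[_ z11].
  by rewrite (le_lt_trans _ th1)// ler_piMr// ltW.
apply: (mulIf den); rewrite divfK//.
by rewrite mulrBr mulr1 {1}FE mulrC addrK.
Qed.

(** This is the coefficient of the negative binomial law at time 1, where that law becomes
    geometric. *)
Lemma gen_binomial_nat n : gen_binomial (n%:R : R) n = 1.
Proof.
rewrite /gen_binomial (_ : \prod_(k < n) _ = n`!%:R).
  by rewrite divff// pnatr_eq0 -lt0n fact_gt0.
rewrite -ffactnn ffact_prod natr_prod; apply: eq_bigr => k _.
by rewrite natrB// ltnW.
Qed.

Lemma nat_process_sigma (B : R -> T -> nat) (s : R) (A : nat -> Prop) :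
  0 <= s -> sigma_process (nat_process B) [set w | A (B s w)].
Proof.
move=> s0; apply: sub_gen_smallest; exists s => //.
exists (\bigcup_(n in [set n | A n]) [set n%:R]).
  by apply: bigcup_measurable => n _; exact: measurable_set1.
rewrite setTI; apply/seteqP; split => [w [n /= An] /eqP|w /= AB].
  by rewrite /nat_process eqr_nat => /eqP ->.
by exists (B s w).
Qed.

Lemma sigma_process_measurable (X : R -> T -> R) :
  (forall s, 0 <= s -> measurable_fun [set: T] (X s)) ->
  sigma_process X `<=` measurable.
Proof.
move=> mX; apply: smallest_sub; first exact: sigma_algebra_measurable.
by move=> A [s s0]; apply: sigma_rv_measurable; exact: mX.
Qed.

Lemma neg_binomial_process_exp (theta : R) (B : R -> T -> nat) (L : R -> R[i]) :
  0 < theta -> theta < 1 -> neg_binomial_process P theta B ->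
  ccontinuous L -> L 0 = 0 -> (forall u, 0 <= complex.Re (L u)) ->
  forall s u, 0 <= s ->
    cexpectation P (fun w => cexp (- L u) ^+ B s w) =
    cexp (s%:C * cln ((1 - theta)%:C / (1 - theta%:C * cexp (- L u)))).
Proof.
move=> th0 th1 [levyB PB] cL L0 ReL s u s0.
have mB : forall n, measurable [set w | B 1 w = n].
  move=> n; apply: (@sigma_process_measurable (nat_process B)).
    by case: levyB.
  exact: (@nat_process_sigma B 1 (fun k => k = n)).
(* The absolute value keeps [g u] bounded on the whole line. It changes nothing on the values of the
   process, which lie in the half-line where [g u] is multiplicative. *)
pose g (u x : R) := cexp (- L u * (`|x|)%:C).
have gE v r w : g v (nat_process B r w) = cexp (- L v) ^+ B r w.
  by rewrite /g /nat_process ger0_norm// -cexpMn rmorph_nat mulr_natr.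
have ReCexp v : complex.Re (cexp (- L v)) <= 1.
  have [|+ _] := norm_ReIm_cexp_le1 (z := - L v).
    by rewrite complexReN oppr_le0.
  by rewrite ler_norml => /andP[].
have Reden v : 0 < complex.Re (1 - theta%:C * cexp (- L v)).
  rewrite complexReD complex_realM /= subr_gt0.
  by apply: le_lt_trans th1; apply: ler_piMr; [exact: ltW|exact: ReCexp].
have Req v : 0 < complex.Re ((1 - theta)%:C / (1 - theta%:C * cexp (- L v))).
  by rewrite complex_realM; apply: mulr_gt0; [rewrite subr_gt0|exact: ReV_gt0].
pose M v := cln ((1 - theta)%:C / (1 - theta%:C * cexp (- L v))).
have -> : (fun w => cexp (- L u) ^+ B s w) = fun w => g u (nat_process B s w).
  by apply/funext => w; rewrite gE.
rewrite -/(M u) -[s in RHS]divr1.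
apply: (@levy_semigroup_cexp _ _ _ P `[0, +oo[%classic g
  _ _ _ _ (nat_process B) levyB _ 1 M) => //.
- move=> v; split.
  + apply/ccontinuous_cexp/ccontinuousZ/ccontinuous_real.
    exact: norm_continuous.
  + by rewrite /g normr0 mulr0 cexp0.
  + move=> x; apply: norm_ReIm_cexp_le1.
    by rewrite mulrC complex_realM /= complexReN mulrN oppr_le0 mulr_ge0.
  + move=> x y /=; rewrite !in_itv /= !andbT => x0 y0.
    by rewrite /g -cexpD -mulrDr -rmorphD !ger0_norm// addr_ge0.
- move=> x; apply: ccontinuous_cexp; apply: ccontinuousM.
    exact: ccontinuousN.
  exact: ccontinuous_cst.
- by move=> x; rewrite /g L0 oppr0 mul0r cexp0.
- move=> r r0; rewrite (_ : _ @^-1` _ = set0) ?measure0//.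
  apply/seteqP; split => w //=; rewrite in_itv /= andbT; apply.
  exact: ler0n.
- apply: ccontinuous_cln => //; apply: ccontinuousM.
    exact: ccontinuous_cst.
  apply: ccontinuousV => [v|]; first exact: Re_gt0_neq0.
  apply: ccontinuousD; first exact: ccontinuous_cst.
  apply/ccontinuousN/ccontinuousZ/ccontinuous_cexp.
  exact: ccontinuousN.
- rewrite /M L0 oppr0 cexp0 mulr1 rmorphB rmorph1 divff ?cln1//.
  by rewrite -(rmorph1 (real_complex R)) -rmorphB fmorph_eq0 subr_eq0 gt_eqF.
move=> v; rewrite cexp_cln//.
have -> : (fun w => g v (nat_process B 1 w)) = fun w => cexp (- L v) ^+ B 1 w.
  by apply/funext => w; rewrite gE.
apply: geometric_generating_function => // n.
by rewrite PB// addrK gen_binomial_nat powRr1 ?mulr1// subr_ge0 ltW.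
Qed.

End negative_binomial.

(** * Logarithm of the characteristic function of a subordinated process *)

Section subordination.
Context d (T : measurableType d) (R : realType) (P : probability T R).

(** Passing to the type carrying the generated sigma-algebra makes the closure properties of
    measurable functions available. *)
Lemma measurable_wrt_generated (C : set (set T)) (X : T -> R) :
  measurable_wrt <<s C >> X <->
  measurable_fun [set: g_sigma_algebraType C] (X : g_sigma_algebraType C -> R).
Proof.
split=> [XC _ A mA|mX A mA]; first by rewrite setTI; exact: XC.
by have := mX measurableT A mA; rewrite setTI.
Qed.

(* Conditionally on [B (lambda * t) = n] the characteristic function of the
   subordinated variable is [exp (- (lambda * t + n) * L u)]. *)
Lemma ln_char_subordinated (C : set (set T)) (lambda theta t : R)
    (B : R -> T -> nat) (H : R -> T -> R) (L : R -> R[i]) :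
  0 < lambda -> 0 < theta -> theta < 1 -> 0 <= t ->
  neg_binomial_process P theta B ->
  independent2 P (sigma_process (nat_process B)) <<s C >> ->
  (forall s, 0 <= s -> measurable_fun [set: T] (H s)) ->
  (forall s, 0 <= s -> measurable_wrt <<s C >> (H s)) ->
  ccontinuous L -> L 0 = 0 -> (forall u, 0 <= complex.Re (L u)) ->
  (forall u, 0 < complex.Re (cexp (L u) - theta%:C)) ->
  (forall s u : R, 0 <= s -> cexpectation P (fun w => cexp ('i * (u * H s w)%:C)) =
    cexp ((- (lambda * s))%:C * L u)) ->
  ln_char P (fun w => H (t + lambda^-1 * (B (lambda * t) w)%:R) w) =
  (lambda * t)%:C * cln ((1 - theta)%:C / (cexp (L 1) - theta%:C)).
Proof.
move=> l0 th0 th1 t0 negB ind mH HC cL L0 ReL ReW HE.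
have lt0 : 0 <= lambda * t by rewrite mulr_ge0 ?(ltW l0).
pose N w := B (lambda * t) w.
have mN : forall n, measurable [set w | N w = n].
  move=> n; apply: (@sigma_process_measurable _ _ _ (nat_process B)).
    by case: negB => -[].
  exact: (@nat_process_sigma _ _ _ B _ (fun k => k = n)).
have sn0 n : 0 <= t + lambda^-1 * n%:R.
  by rewrite addr_ge0 ?mulr_ge0 ?invr_ge0 ?(ltW l0).
have Req u : 0 < complex.Re ((1 - theta)%:C / (cexp (L u) - theta%:C)).
  by rewrite complex_realM; apply: mulr_gt0; [rewrite subr_gt0|exact: ReV_gt0].
have cW : ccontinuous (fun u => cexp (L u) - theta%:C).
  by apply: ccontinuousD; [exact: ccontinuous_cexp|exact: ccontinuous_cst].
have Req' u : 0 < complex.Re ((1 - theta)%:C / (1 - theta%:C * cexp (- L u))).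
  have e1 : complex.Re (cexp (- L u)) <= 1.
    have [|+ _] := norm_ReIm_cexp_le1 (z := - L u).
      by rewrite complexReN oppr_le0.
    by rewrite ler_norml => /andP[].
  rewrite complex_realM; apply: mulr_gt0; [by rewrite subr_gt0|apply: ReV_gt0].
  rewrite complexReD complexReN complex_realM /= subr_gt0.
  by apply: le_lt_trans th1; apply: ler_piMr; [exact: ltW|].
pose psi u : R[i] := cln ((1 - theta)%:C / (cexp (L u) - theta%:C)).
have th_neq0 : (1 - theta)%:C != 0 :> R[i] by rewrite fmorph_eq0 subr_eq0 gt_eqF.
have cpsi : ccontinuous psi.
  apply: ccontinuous_cln => //; apply: ccontinuousM; first exact: ccontinuous_cst.
  by apply: ccontinuousV => // u; exact: Re_gt0_neq0.
have psi0 : psi 0 = 0.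
  by rewrite /psi L0 cexp0 -(rmorph1 (real_complex R)) -rmorphB divff// cln1.
(* Multiplying numerator and denominator by [cexp (- L u)] shows that both sides have the same
   exponential; being continuous and null at 0, they coincide, which settles the branch. *)
have psiE : psi = fun u => - L u + cln ((1 - theta)%:C / (1 - theta%:C * cexp (- L u))).
  apply: cexp_ccontinuous_inj => //.
  - apply: ccontinuousD; first exact: ccontinuousN.
    apply: ccontinuous_cln => //; apply: ccontinuousM; first exact: ccontinuous_cst.
    apply: ccontinuousV => [u|].
      apply/eqP => den0; have := Req' u.
      by rewrite den0 invr0 mulr0 ltxx.
    apply: ccontinuousD; first exact: ccontinuous_cst.
    exact/ccontinuousN/ccontinuousZ/ccontinuous_cexp/ccontinuousN.
  - by rewrite L0 oppr0 cexp0 mulr1 -(rmorph1 (real_complex R)) -rmorphB divff// cln1 addr0.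
  - move=> u; rewrite cexpD !cexp_cln// cexpN.
    have e0 := cexp_neq0 (L u).
    have W0 := Re_gt0_neq0 (ReW u).
    have W1 : 1 - theta%:C * (cexp (L u))^-1 != 0.
      by rewrite -(mulfV e0) -mulrBl mulf_neq0// invr_eq0.
    by field; rewrite e0 W0.
rewrite /ln_char (@distinguished_logE _ _ (fun u => (lambda * t)%:C * psi u))//.
- exact: ccontinuousZ.
- by rewrite psi0 mulr0.
move=> u; rewrite /char_fun.
pose Y n w := cexp ('i * (u * H (t + lambda^-1 * n%:R) w)%:C).
have [mcRe mcIm] := measurable_cexp_i u.
have c1 (x : R) : `|complex.Re (cexp ('i * (u * x)%:C))| <= 1 /\
                  `|complex.Im (cexp ('i * (u * x)%:C))| <= 1.
  by case: (semicharacter_cexp_i u).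
have -> : cexpectation P (fun w => cexp ('i * (u * H (t + lambda^-1 * (N w)%:R) w)%:C)) =
    cexpectation P (fun w => Y (N w) w) by [].
rewrite (cexpectation_nat_mixture mN ind).
(* At time [t + n / lambda] the conditional exponent is [- (lambda * t + n) * L u]; the part
   depending on [n] becomes the [n]-th power of [cexp (- L u)]. *)
- have -> : (fun w => cexpectation P (Y (N w))) =
      fun w => cexp ((- (lambda * t))%:C * L u) * cexp (- L u) ^+ N w.
    apply/funext => w; rewrite /Y HE// mulrDr (mulrA lambda) mulfV ?gt_eqF// mul1r.
    rewrite -cexpMn -cexpD opprD rmorphD mulrDl; congr (cexp (_ + _)).
    by rewrite rmorphN rmorph_nat mulNr mulNrn mulr_natl.
  have z1 n : `|complex.Re (cexp (- L u) ^+ n)| <= 1 /\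
              `|complex.Im (cexp (- L u) ^+ n)| <= 1.
    rewrite -cexpMn; apply: norm_ReIm_cexp_le1.
    by rewrite complexReMn complexReN mulrn_wle0// oppr_le0.
  rewrite cexpectationZ; last first.
    split; split; [|by exists 1 => w; case: (z1 (N w))|
                    |by exists 1 => w; case: (z1 (N w))].
      exact: (measurable_fun_nat_mixture mN
        (Y := fun n _ => complex.Re (cexp (- L u) ^+ n))).
    exact: (measurable_fun_nat_mixture mN
      (Y := fun n _ => complex.Im (cexp (- L u) ^+ n))).
  rewrite (neg_binomial_process_exp th0 th1 negB)// -cexpD psiE.
  by rewrite mulrDr rmorphN mulNr mulrN.
- by move=> A; exact: nat_process_sigma.
- by move=> n; apply: bounded_crv_cexp_i; exact: mH.
- move=> n; split; apply/measurable_wrt_generated.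
    by apply: (measurableT_comp mcRe); apply/measurable_wrt_generated; exact: HC.
  by apply: (measurableT_comp mcIm); apply/measurable_wrt_generated; exact: HC.
- by move=> n w; exact: c1.
Qed.

End subordination.

(** * The codifference *)

Section rational_identities.
Context {F : fieldType}.
Implicit Types a b w t D : F.

Lemma gamma_denominator1 a w t : a != 0 ->
  a * (1 - t) - w = a * (1 - w * (1 / a) - t).
Proof. by move=> a0; field. Qed.

Lemma gamma_denominator2 a w t : a != 0 ->
  a * (1 - t) + w = a * (1 - w * (- 1 / a) - t).
Proof. by move=> a0; field. Qed.

(** The two sides differ by exactly [w ^+ 2 + 1]. Over an abstract field the imaginary unit is a
    variable that [field] can handle. *)
Lemma gamma_denominator a b w t : a != 0 -> b != 0 -> w ^+ 2 = - 1 ->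
  a * b * (1 - t) + w * a - w * b + 1 =
  a * b * ((1 - w * (1 / a)) * (1 - w * (- 1 / b)) - t).
Proof.
move=> a0 b0 w2; apply/eqP; rewrite -subr_eq0; apply/eqP.
transitivity (w ^+ 2 + 1); last by rewrite w2 addNr.
by field; rewrite a0 b0.
Qed.

Lemma gamma_quotient1 a b t D : a != 0 -> b != 0 -> D != 0 ->
  a * b * t / (a * b * D) = t / D.
Proof. by move=> a0 b0 D0; field; rewrite a0 b0 D0. Qed.

Lemma gamma_quotient2 a b t D D' : a != 0 -> b != 0 -> D != 0 -> D' != 0 ->
  a * b * t ^+ 2 / ((a * D) * (b * D')) = t / D * (t / D').
Proof. by move=> a0 b0 D0 D0'; field; rewrite a0 b0 D0 D0'. Qed.

End rational_identities.

Section codifference_of_gamma.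
Context {R : realType}.

(* [- gamma_exponent a u] is the characteristic exponent of a gamma process of
   rate [a] and unit shape. *)
Definition gamma_exponent (a u : R) : R[i] := cln (1 - 'i * (a^-1 * u)%:C).

Lemma gamma_baseE (a u : R) : 1 - 'i * (a^-1 * u)%:C = 1 -i* (a^-1 * u) :> R[i].
Proof. by apply: complexP => /=; rewrite !(mul0r, mul1r, oppr0, addr0, add0r). Qed.

Lemma gamma_exponent0 a : gamma_exponent a 0 = 0.
Proof. by rewrite /gamma_exponent mulr0 rmorph0 mulr0 subr0 cln1. Qed.

Lemma ccontinuous_gamma_exponent a : ccontinuous (gamma_exponent a).
Proof.
apply: ccontinuous_cln => [u|]; first by rewrite gamma_baseE.
apply: ccontinuousD; first exact: ccontinuous_cst.
exact/ccontinuousN/ccontinuous_i_scale.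
Qed.

Lemma cexp_gamma_exponent a u : cexp (gamma_exponent a u) = 1 -i* (a^-1 * u).
Proof. by rewrite cexp_cln gamma_baseE. Qed.

(** The base has real part 1, hence modulus at least 1. This keeps [cexp (- L u)] in the unit
    disc. *)
Lemma Re_gamma_exponent_ge0 a u : 0 <= complex.Re (gamma_exponent a u).
Proof.
rewrite /gamma_exponent gamma_baseE /= ln_ge0//.
by rewrite -[leLHS]sqrtr1 ler_wsqrtr//= expr1n lerDl sqr_ge0.
Qed.

Lemma ccontinuous_opp (f : R -> R[i]) : ccontinuous f -> ccontinuous (fun u => f (- u)).
Proof.
by move=> [f1 f2]; split => u; apply: (@continuous_comp _ _ _ -%R (fun u => _ (f u)));
  solve [exact: opp_continuous|exact: f1|exact: f2].
Qed.

(** Up to [pi] the cosine is inverted by [acos]; between [pi] and [3 * pi / 2] it is negative. *)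
Lemma cos_eq1_lt3pihalf (x : R) : `|x| < pi + pi / 2 -> cos x = 1 -> x = 0.
Proof.
have pi0 := @pi_gt0 R; move=> xpi cx.
have cx' : cos `|x| = 1.
  by case: (leP 0 x) => x0; [rewrite ger0_norm|rewrite ltr0_norm// cosN].
apply/eqP; rewrite -normr_eq0; apply/eqP.
have [xlepi|pix] := leP `|x| pi.
  by rewrite -[LHS]cosK ?cx' ?acos1// in_itv /= normr_ge0.
have : 0 < cos (`|x| - pi) by apply: cos_gt0_pihalf; apply/andP; split; lra.
by rewrite -oppr_lt0 -cosDpi subrK cx' ltr10.
Qed.

(** All three arguments lie strictly between [- pi / 2] and [pi / 2], so the defect is below
    [3 * pi / 2] in absolute value; having cosine 1, it is 0. *)
Lemma cln_mul (z w : R[i]) : 0 < complex.Re z -> 0 < complex.Re w ->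
  0 < complex.Re (z * w) -> cln (z * w) = cln z + cln w.
Proof.
move=> z0 w0 zw0; apply/esym/eqP; rewrite -subr_eq0; apply/eqP.
set D := _ - _; have : cexp D = 1.
  rewrite /D cexpD cexpN cexpD !cexp_cln// divff//.
  exact: Re_gt0_neq0.
move=> /cexp_eq1[ReD0 cosD]; apply: complexP => //=.
apply: cos_eq1_lt3pihalf => //; rewrite /D !carg_atan//.
move: (atan_gtNpi2 (complex.Im z / complex.Re z))
  (atan_ltpi2 (complex.Im z / complex.Re z))
  (atan_gtNpi2 (complex.Im w / complex.Re w))
  (atan_ltpi2 (complex.Im w / complex.Re w))
  (atan_gtNpi2 (complex.Im (z * w) / complex.Re (z * w)))
  (atan_ltpi2 (complex.Im (z * w) / complex.Re (z * w))).
by rewrite ltr_norml => ? ? ? ? ? ?; apply/andP; split; lra.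
Qed.

End codifference_of_gamma.

Theorem proposition3p3
  (d : measure_display) (T : measurableType d) (R : realType)
  (P : probability T R)
  (q : nat) (lambda theta : R) (a : 'I_q -> R)
  (Z : 'I_q -> R -> T -> R) (B : R -> T -> nat)
  (lambda_gt0 : 0 < lambda) (theta_gt0 : 0 < theta) (theta_lt1 : theta < 1)
  (a_gt0 : forall i, 0 < a i)
  (Z_gamma : forall i, gamma_process P lambda (a i) (Z i))
  (Z_indep : mutually_independent P (fun i => sigma_process (Z i)))
  (B_negbin : neg_binomial_process P theta B)
  (B_indep : independent2 P (sigma_process (nat_process B))
               <<s \bigcup_i sigma_process (Z i) >>)
  (t : R) (t_ge0 : 0 <= t) (i j : 'I_q) :
  let G := gamma_subordinator lambda Z B in
  let omega : R[i] := 'i in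
  let ai : R[i] := (a i)%:C in
  let aj : R[i] := (a j)%:C in
  let th : R[i] := theta%:C in
  codifference P (G i t) (G j t) =
    (lambda * t)%:C
      * cln ((ai * aj * (1 - th))
             / (ai * aj * (1 - th) + omega * ai - omega * aj + 1))
      * (i != j)%:R
    - (lambda * t)%:C
      * cln ((ai * aj * (1 - th) ^+ 2)
             / ((ai * (1 - th) - omega) * (aj * (1 - th) + omega))).

Proof.
move=> G omega ai aj th.
set C := \bigcup_i sigma_process (Z i) in B_indep.
have levyZ k : levy_process P (Z k) := (Z_gamma k).1.
have mZ k s : 0 <= s -> measurable_fun [set: T] (Z k s).
  by have [h _] := levyZ k; exact: h.
have ZC k s : 0 <= s -> measurable_wrt <<s C >> (Z k s).
  move=> s0 A mA; apply: sub_gen_smallest; exists k => //.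
  apply: sub_gen_smallest; exists s => //.
  by exists A => //; rewrite setTI.
have ZE k (s u : R) : 0 <= s -> cexpectation P (fun w => cexp ('i * (u * Z k s w)%:C)) =
    cexp ((- (lambda * s))%:C * gamma_exponent (a k) u).
  exact: gamma_process_char_fun.
have sub := @ln_char_subordinated _ _ _ P C lambda theta t B.
(* At [u = 1] the exponential of the gamma exponent is [1 - i / a_i]; for [- G j] below, the
   exponent is taken at [- u], which gives [1 + i / a_j]. *)
have XE : ln_char P (G i t) =
    (lambda * t)%:C * cln ((1 - theta)%:C / (1 -i* ((a i)^-1 * 1) - theta%:C)).
  rewrite -cexp_gamma_exponent; apply: (sub (Z i)) => //; try solve
    [exact: mZ|exact: ZC|exact: ccontinuous_gamma_exponent
    |exact: gamma_exponent0|exact: Re_gamma_exponent_ge0].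
  - by move=> u; rewrite cexp_gamma_exponent /= subr_gt0.
  - by move=> s u; exact: ZE.
have YE : ln_char P (\- G j t) =
    (lambda * t)%:C * cln ((1 - theta)%:C / (1 -i* ((a j)^-1 * - 1) - theta%:C)).
  rewrite -cexp_gamma_exponent; apply: (sub (fun s w => - Z j s w)
    (fun u => gamma_exponent (a j) (- u))) => //.
  - by move=> s s0; apply: measurableT_comp => //; exact: mZ.
  - move=> s s0; apply/measurable_wrt_generated.
    apply: (@measurable_funN _ (g_sigma_algebraType C)).
    by apply/measurable_wrt_generated; exact: ZC.
  - exact/ccontinuous_opp/ccontinuous_gamma_exponent.
  - by rewrite oppr0 gamma_exponent0.
  - by move=> u; exact: Re_gamma_exponent_ge0.
  - by move=> u; rewrite cexp_gamma_exponent /= subr_gt0.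
  - move=> s u s0; rewrite -ZE//; congr cexpectation.
    by apply/funext => w; rewrite mulrN mulNr.
have ai0 : ai != 0 by rewrite fmorph_eq0 gt_eqF.
have aj0 : aj != 0 by rewrite fmorph_eq0 gt_eqF.
(* For distinct indices [Z i] and [Z j] are independent, so the exponents of [Z i] and [- Z j] add
   up. *)
have DE : i != j -> ln_char P (G i t \- G j t) =
    (lambda * t)%:C * cln ((1 - theta)%:C /
      ((1 -i* ((a i)^-1 * 1)) * (1 -i* ((a j)^-1 * - 1)) - theta%:C)).
  move=> ij.
  have indij : independent2 P (sigma_process (Z i)) (sigma_process (Z j)).
    apply: (mutually_independent2 ij _ _ Z_indep);
      by apply: sigma_process_measurable; exact: mZ.
  have cm k s u : 0 <= s -> cmeasurable_wrt (sigma_process (Z k))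
      (fun w => cexp ('i * (u * Z k s w)%:C)).
    move=> s0; have [mRe mIm] := measurable_cexp_i u.
    split=> A mA; apply: sub_gen_smallest; exists s => //;
      [exact: (@measurable_wrt_sigma_rv _ _ _ (Z k s) _ mRe A mA)
      |exact: (@measurable_wrt_sigma_rv _ _ _ (Z k s) _ mIm A mA)].
  rewrite -!cexp_gamma_exponent -cexpD.
  apply: (sub (fun s => Z i s \- Z j s)
    (fun u => gamma_exponent (a i) u + gamma_exponent (a j) (- u))) => //.
  - by move=> s s0; apply: measurable_funB; exact: mZ.
  - move=> s s0; apply/measurable_wrt_generated.
    apply: (@measurable_funB _ (g_sigma_algebraType C));
      by apply/measurable_wrt_generated; exact: ZC.
  - apply: ccontinuousD; first exact: ccontinuous_gamma_exponent.
    exact/ccontinuous_opp/ccontinuous_gamma_exponent.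
  - by rewrite oppr0 !gamma_exponent0 addr0.
  - by move=> u; rewrite complexReD addr_ge0// Re_gamma_exponent_ge0.
  (* The real part of the product of the two bases is [1 + u ^+ 2 / (a_i * a_j)], above [theta] for
     every [u]. *)
  - move=> u; rewrite cexpD !cexp_gamma_exponent /=.
    rewrite (_ : _ - _ = (1 - theta) + (a i)^-1 * (a j)^-1 * u ^+ 2); last by ring.
    by rewrite ltr_pwDl ?subr_gt0// mulr_ge0 ?sqr_ge0// mulr_ge0// invr_ge0 ltW.
  - move=> s u s0.
    transitivity (cexpectation P (fun w => cexp ('i * (u * Z i s w)%:C) *
                                  cexp ('i * (- u * Z j s w)%:C))).
      congr cexpectation; apply/funext => w; rewrite -cexpD -mulrDr -rmorphD.
      by rewrite mulrBr mulNr.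
    rewrite (cexpectation_indep indij); [|exact: cm|exact: cm|
      exact/bounded_crv_cexp_i/mZ|exact/bounded_crv_cexp_i/mZ].
    by rewrite !ZE// -cexpD mulrDr.
have baseE (k : 'I_q) (x : R) : 1 -i* ((a k)^-1 * x) = 1 - omega * (x%:C / (a k)%:C).
  by rewrite -gamma_baseE rmorphM fmorphV (mulrC x%:C).
set D1 := 1 -i* ((a i)^-1 * 1) - theta%:C in XE.
set D2 := 1 -i* ((a j)^-1 * - 1) - theta%:C in YE.
have ReD1 : complex.Re D1 = 1 - theta by [].
have ReD2 : complex.Re D2 = 1 - theta by [].
have th0 : 0 < 1 - theta by rewrite subr_gt0.
have D10 : D1 != 0 by apply: Re_gt0_neq0; rewrite ReD1.
have D20 : D2 != 0 by apply: Re_gt0_neq0; rewrite ReD2.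
pose W := (1 -i* ((a i)^-1 * 1)) * (1 -i* ((a j)^-1 * - 1)) - theta%:C.
have W0 : W != 0.
  apply: Re_gt0_neq0; rewrite /W /= (_ : _ - _ =
    (1 - theta) + (a i)^-1 * (a j)^-1); last by ring.
  by rewrite ltr_pwDl// mulr_ge0// invr_ge0 ltW.
have aiD1 : ai * (1 - th) - omega = ai * D1.
  by rewrite /D1 baseE rmorph1; exact: gamma_denominator1.
have ajD2 : aj * (1 - th) + omega = aj * D2.
  by rewrite /D2 baseE rmorphN1; exact: gamma_denominator2.
have aiajD : ai * aj * (1 - th) + omega * ai - omega * aj + 1 = ai * aj * W.
  rewrite /W !baseE rmorph1 rmorphN1; apply: gamma_denominator => //.
  exact: sqr_i.
have thC : 1 - th = (1 - theta)%:C by rewrite rmorphB rmorph1.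
have -> : ai * aj * (1 - th) ^+ 2 /
    ((ai * (1 - th) - omega) * (aj * (1 - th) + omega)) =
    ((1 - theta)%:C / D1) * ((1 - theta)%:C / D2).
  by rewrite aiD1 ajD2 -thC; exact: gamma_quotient2.
have -> : ai * aj * (1 - th) / (ai * aj * (1 - th) + omega * ai - omega * aj + 1) =
    (1 - theta)%:C / W.
  by rewrite aiajD -thC; exact: gamma_quotient1.
have ReQ (D : R[i]) : 0 < complex.Re D -> 0 < complex.Re ((1 - theta)%:C / D).
  by move=> D0; rewrite complex_realM; apply: mulr_gt0 => //; exact: ReV_gt0.
(* The last logarithm splits without a [2 * pi] correction: both quotients and their product have
   positive real part, since that of [D1 * D2] is [(1 - theta) ^+ 2 + 1 / (a_i * a_j)]. *)
rewrite (@cln_mul _ (_ / D1)); [|by apply: ReQ; rewrite ReD1|by apply: ReQ; rewrite ReD2|].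
  2: rewrite (_ : _ * _ = (1 - theta)%:C * ((1 - theta)%:C / (D1 * D2))).
  2: { rewrite complex_realM; apply: mulr_gt0 => //; apply: ReQ.
       rewrite complexReM ReD1 ReD2 /= (_ : _ - _ =
         (1 - theta) ^+ 2 + (a i)^-1 * (a j)^-1); last by ring.
       by rewrite ltr_pwDl ?exprn_gt0// mulr_ge0// invr_ge0 ltW. }
  2: by rewrite invfM mulrACA [RHS]mulrA.
rewrite /codifference XE YE mulrDr.
(* For equal indices the difference is identically 0, its characteristic function is 1 with
   distinguished logarithm 0, and the indicator removes the first term. *)
have [ij|ij] := eqVneq i j; last by rewrite DE// [in RHS]mulr1 opprD addrA.
rewrite ij (_ : ln_char P (G j t \- G j t) = 0); first by rewrite mulr0 !sub0r opprD.
rewrite /ln_char (@distinguished_logE _ _ (fun=> 0))//; first exact: ccontinuous_cst.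
move=> u; rewrite /char_fun cexp0 (_ : (fun w => _) = cst 1) ?cexpectation_cst//.
by apply/funext => w /=; rewrite subrr mulr0 rmorph0 mulr0 cexp0.
Qed.
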